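(* Let $a\in\mathcal{K}_{C_a,\delta_a}$, $C_a>0$, $\delta_a\ge0$, $C>C_a$, $\delta\ge\max\{\delta_a,1\}$. Let $A'$ be the operator in $\mathcal{L}_{C,\delta}$ given by $$(A'G)(\eta)=\int_{\Gamma_0}G(\eta\cup\xi)\,a(\xi)\,d\lambda(\xi),\qquad G\in D(A'),$$ where $D(A')$ consists of all $G\in\mathcal{L}_{C,\delta}$ such that $A'G\in\mathcal{L}_{C,\delta}$. Then there exists $z_0>0$ such that for all $z>z_0$ the resolvent $R_z(A')=(z\mathbf{1}-A')^{-1}$ of $A'$ in the space $\mathcal{L}_{C,\delta}$ exists and has the form $$\bigl(R_z(A')G\bigr)(\eta)=\sum_{n=0}^\infty\frac{1}{z^{n+1}}\int_{\Gamma_0}G(\eta\cup\xi)\,a^{\ast n}(\xi)\,d\lambda(\xi),\qquad G\in\mathcal{L}_{C,\delta},$$ for $\lambda$-a.a. $\eta\in\Gamma_0$.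
   Context: Let $X$ be a connected oriented non-compact Riemannian $C^\infty$-manifold with Borel $\sigma$-algebra $\mathcal{B}(X)$, and let $\mathcal{B}_{\mathrm c}(X)$ be the class of Borel sets with compact closure. Let $m$ be a non-atomic Radon measure on $X$: $m(\Lambda)<\infty$ for $\Lambda\in\mathcal{B}_{\mathrm c}(X)$ and $m(\{x\})=0$ for $x\in X$. Assume there is an increasing sequence $\Lambda_n\in\mathcal{B}_{\mathrm c}(X)$ with $\bigcup_n\Lambda_n=X$. For $n\in\mathbb{N}$ let $\Gamma^{(n)}=\{\eta\subset X: |\eta|=n\}$, where $|\eta|$ is the number of points of $\eta$; $\Gamma^{(0)}=\{\emptyset\}$. $\Gamma^{(n)}$ is identified with the quotient of $\widetilde{X^n}=\{(x_1,\dots,x_n)\in X^n: x_k\neq x_l \text{ if } k\ne l\}$ by the permutation group $S_n$ and carries the quotient topology. The space of finite configurations is the disjoint union $\Gamma_0=\bigsqcup_{n\ge 0}\Gamma^{(n)}$ with the disjoint-union topology and its Borel $\sigma$-algebra. Let $m^{(n)}$ be the image on $\Gamma^{(n)}$ of $m^{\otimes n}$ (restricted to $\widetilde{X^n}$) under $(x_1,\dots,x_n)\mapsto\{x_1,\dots,x_n\}$, and $m^{(0)}(\{\emptyset\})=1$. The Lebesgue--Poisson measure is $\lambda=\sum_{n=0}^\infty\frac1{n!}m^{(n)}$ on $\Gamma_0$. For measurable $G_1,G_2:\Gamma_0\to\mathbb{R}$, the $\ast$-convolution is $(G_1\ast G_2)(\eta)=\sum_{\xi\subset\eta}G_1(\xi)G_2(\eta\setminus\xi)$.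 Powers: $a^{\ast n}$ is the $n$-fold $\ast$-convolution of $a$ with itself, and $a^{\ast 0}(\eta)=1^\ast(\eta)=0^{|\eta|}$ (equal to $1$ at $\eta=\emptyset$ and $0$ otherwise), the unit for $\ast$. For $C>0$, $\delta\ge0$, $\mathcal{K}_{C,\delta}$ is the Banach space of measurable functions $k:\Gamma_0\to\mathbb{R}$ (up to $\lambda$-a.e. equality) with $|k(\eta)|\le \mathrm{const}\cdot C^{|\eta|}(|\eta|!)^\delta$ for $\lambda$-a.a. $\eta$, with norm $\|k\|_{C,\delta}=\operatorname{ess\,sup}_{\eta\in\Gamma_0}\frac{|k(\eta)|}{C^{|\eta|}(|\eta|!)^\delta}$. The Banach space $\mathcal{L}_{C,\delta}$ is $L^1\bigl(\Gamma_0, C^{|\eta|}(|\eta|!)^\delta d\lambda(\eta)\bigr)$ (real-valued functions), with norm $\|G\|_{\mathcal{L}_{C,\delta}}=\int_{\Gamma_0}|G(\eta)|C^{|\eta|}(|\eta|!)^\delta d\lambda(\eta)$. *)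

(* Defs.v *)
From HB Require Import structures.
From mathcomp Require Import all_boot all_order all_algebra finmap.
From mathcomp Require Import all_classical all_reals all_analysis.

Set Implicit Arguments.
Unset Strict Implicit.
Unset Printing Implicit Defensive.

Import Order.TTheory GRing.Theory Num.Theory.
Import numFieldNormedType.Exports.

Local Open Scope classical_set_scope.
Local Open Scope ring_scope.

Section Smooth.
Variables (R : realType) (n : nat).

(* [U] is meant to be open, so that derivatives at points of [U] only depend
   on the values of [f] on [U]. *)
Fixpoint Ck_on (k : nat) (U : set 'rV[R]_n) (f : 'rV[R]_n -> R) : Prop :=
  {within U, continuous f} /\
  if k is k'.+1 then
    forall i : 'I_n,
      (forall x, U x -> derivable f x (delta_mx 0 i)) /\
      Ck_on k' U ('D_(delta_mx 0 i) f)
  else True.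

Definition smooth_on (U : set 'rV[R]_n) (f : 'rV[R]_n -> R) : Prop :=
  forall k, Ck_on k U f.

End Smooth.

(* A homeomorphism from an open subset of [X] onto an open subset of [R^n];
   the values of [chart_map] and [chart_inv] outside these sets are junk. *)
Record chart (R : realType) (X : topologicalType) (n : nat) := Chart {
  chart_dom : set X;
  chart_map : X -> 'rV[R]_n;
  chart_inv : 'rV[R]_n -> X;
  chart_dom_open : open chart_dom;
  chart_img_open : open (chart_map @` chart_dom);
  chart_map_continuous : {within chart_dom, continuous chart_map};
  chart_inv_continuous : {within chart_map @` chart_dom, continuous chart_inv};
  chart_mapK : {in chart_dom, cancel chart_map chart_inv}
}.

Section Transition.
Context {R : realType} {X : topologicalType} {n : nat}.
Implicit Types c : chart R X n.

Definition chart_img c : set 'rV[R]_n := chart_map c @` chart_dom c.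

Definition overlap c c' : set 'rV[R]_n :=
  chart_map c @` (chart_dom c `&` chart_dom c').

Definition transition c c' : 'rV[R]_n -> 'rV[R]_n :=
  chart_map c' \o chart_inv c.

End Transition.

(* The orientation is given by an oriented smooth atlas. [metric c x] is the
   Gram matrix of the Riemannian metric, in the coordinates of the chart [c],
   at the point of coordinates [x]. Tangent vectors are row vectors, hence
   ['J f x] maps [v] to [v *m 'J f x]. *)
Record orientedRiemannian (R : realType) (n : nat) := OrientedRiemannian {
  carrier :> ptopologicalType;
  carrier_hausdorff : hausdorff_space carrier;
  carrier_second_countable : @second_countable carrier;
  carrier_connected : connected [set: carrier];
  carrier_noncompact : ~ compact [set: carrier];
  atlas : set (chart R carrier n);
  atlas_cover : \bigcup_(c in atlas) chart_dom c = [set: carrier];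
  atlas_smooth : forall c c', atlas c -> atlas c' ->
    forall i, smooth_on (overlap c c') (fun x => transition c c' x 0 i);
  atlas_oriented : forall c c', atlas c -> atlas c' ->
    forall x, overlap c c' x -> 0 < \det ('J (transition c c') x);
  metric : chart R carrier n -> 'rV[R]_n -> 'M[R]_n;
  metric_smooth : forall c, atlas c ->
    forall i j, smooth_on (chart_img c) (fun x => metric c x i j);
  metric_sym : forall c, atlas c ->
    forall x, chart_img c x -> (metric c x)^T = metric c x;
  metric_pos : forall c, atlas c -> forall x, chart_img c x ->
    forall v : 'rV[R]_n, v != 0 -> 0 < (v *m metric c x *m v^T) 0 0;
  metric_transition : forall c c', atlas c -> atlas c' ->
    forall x, overlap c c' x ->
      metric c x = 'J (transition c c') x *m metric c' (transition c c' x)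
                   *m ('J (transition c c') x)^T
}.

Notation borel T := (g_sigma_algebraType (@open T)).

Definition borel_precompact (T : ptopologicalType) (A : set (borel T)) : Prop :=
  measurable A /\ compact (closure (A : set T)).

Record nonatomicRadon (R : realType) (T : ptopologicalType) := NonatomicRadon {
  radon_measure :> {measure set (borel T) -> \bar R};
  radon_fin : forall A, borel_precompact A -> (radon_measure A < +oo)%E;
  radon_nonatomic : forall x : T, radon_measure [set x] = 0%E;
  radon_exhaustion : exists A : nat -> set (borel T),
    [/\ forall k, borel_precompact (A k),
        forall k, A k `<=` A k.+1 &
        \bigcup_k A k = [set: borel T]]
}.

Section RadonSigmaFinite.
Variables (R : realType) (T : ptopologicalType) (m : nonatomicRadon R T).

Lemma radon_sigma_finite : sigma_finite setT m.
Proof.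
have [A [Ac _ AT]] := radon_exhaustion m.
exists A; first by rewrite AT.
by move=> k; split; [exact: (Ac k).1 | exact: radon_fin].
Qed.

Definition radon (A : set (borel T)) : \bar R := m A.

HB.instance Definition _ := Measure.copy radon (radon_measure m).
HB.instance Definition _ :=
  Measure_isSigmaFinite.Build _ _ _ radon radon_sigma_finite.

End RadonSigmaFinite.

Section TensorStep.
Variables (d : measure_display) (T : measurableType d) (R : realType).
Variable m : {sigma_finite_measure set T -> \bar R}.
Variables (k : nat) (mu : {sigma_finite_measure set (k.-tuple T) -> \bar R}).

Definition tcons (p : T * k.-tuple T) : k.+1.-tuple T := [tuple of p.1 :: p.2].

Lemma measurable_tcons : measurable_fun [set: T * k.-tuple T] tcons.
Proof. exact: measurable_cons. Qed.

Lemma measurable_tuncons :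
  measurable_fun [set: k.+1.-tuple T] (fun t => (thead t, [tuple of behead t])).
Proof.
apply/measurable_fun_pairP; split => /=.
  exact: measurable_tnth.
exact: measurable_behead.
Qed.

Definition tensor_step : set (k.+1.-tuple T) -> \bar R :=
  pushforward (m \x mu)%E tcons.

Let tensor_step0 : tensor_step set0 = 0%E.
Proof. by rewrite /tensor_step /pushforward preimage_set0 measure0. Qed.

Let tensor_step_ge0 A : (0 <= tensor_step A)%E.
Proof. by rewrite /tensor_step /pushforward measure_ge0. Qed.

Let tensor_step_sigma_additive : semi_sigma_additive tensor_step.
Proof.
have mp A : measurable A -> measurable (tcons @^-1` A).
  by move=> mA; rewrite -[X in measurable X]setTI; exact: measurable_tcons.
move=> F mF tF mUF; rewrite /tensor_step /pushforward preimage_bigcup.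
apply: measure_semi_sigma_additive; first by move=> i; exact: mp.
  apply/trivIsetP => i j _ _ ij; rewrite -preimage_setI.
  by move/trivIsetP : tF => /(_ _ _ _ _ ij) -> //; rewrite preimage_set0.
by rewrite -preimage_bigcup; exact: mp.
Qed.

HB.instance Definition _ := isMeasure.Build _ _ _ tensor_step
  tensor_step0 tensor_step_ge0 tensor_step_sigma_additive.

Let tensor_step_sigma_finite : sigma_finite setT tensor_step.
Proof.
have /sigma_finiteP[F [FT ndF Ffin]] := sigma_finiteT m.
have /sigma_finiteP[G [GT ndG Gfin]] := sigma_finiteT mu.
pose tuncons (t : k.+1.-tuple T) := (thead t, [tuple of behead t]).
exists (fun i => tuncons @^-1` (F i `*` G i)).
  apply/esym; rewrite -subTset => t _ /=.
  have : [set: T] (thead t) by [].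
  have : [set: k.-tuple T] [tuple of behead t] by [].
  rewrite FT GT => -[j _ Gj] [i _ Fi]; exists (maxn i j) => //; split => /=.
    by move: Fi; exact/subsetPset/ndF/leq_maxl.
  by move: Gj; exact/subsetPset/ndG/leq_maxr.
move=> i; have [mF Foo] := Ffin i; have [mG Goo] := Gfin i; split.
  rewrite -[X in measurable X]setTI; apply: measurable_tuncons => //.
  exact: measurableX.
rewrite /tensor_step /pushforward -comp_preimage.
rewrite (_ : _ \o tcons = id) ?preimage_id.
  by rewrite product_measure1E// lte_mul_pinfty// ge0_fin_numE.
by apply/funext => -[x t] /=; congr pair; exact/val_inj.
Qed.

HB.instance Definition _ := Measure_isSigmaFinite.Build _ _ _ tensor_step
  tensor_step_sigma_finite.

End TensorStep.

Section TensorPower.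
Variables (d : measure_display) (T : measurableType d) (R : realType).
Variable m : {sigma_finite_measure set T -> \bar R}.

Fixpoint tensor_power (k : nat) : {sigma_finite_measure set (k.-tuple T) -> \bar R} :=
  if k is k'.+1 then [the {sigma_finite_measure set (k'.+1.-tuple T) -> \bar R}
    of tensor_step m (tensor_power k')]
  else [the {sigma_finite_measure set (0.-tuple T) -> \bar R} of \d_[tuple]].

End TensorPower.

Definition config (T : choiceType) : Type := {fset T}.

HB.instance Definition _ (T : choiceType) := Choice.on (config T).
HB.instance Definition _ (T : choiceType) := isPointed.Build (config T) fset0.

Definition config_of (T : choiceType) (k : nat) (t : k.-tuple T) : config T :=
  [fset x in tval t]%fset.

Section ConfigTopology.
Variable T : topologicalType.

Definition row_tuple (k : nat) (x : 'rV[T]_k) : k.-tuple T :=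
  [tuple x 0 i | i < k].

Definition offdiag (k : nat) : set 'rV[T]_k := [set x | uniq (row_tuple x)].

(* The [k]-point configurations are the quotient of [offdiag k] by the
   permutations of coordinates, and [config T] is their disjoint union: a set
   is open iff its preimage in each [offdiag k] is open. *)
Definition config_open (A : set (config T)) : Prop :=
  forall k, @open (subspace (@offdiag k)) [set x | A (config_of (row_tuple x))].

Let config_openT : config_open setT.
Proof. by move=> k; exact: openT. Qed.

Let config_openI : setI_closed config_open.
Proof. by move=> A B oA oB k; apply: openI; [exact: oA | exact: oB]. Qed.

Let config_open_bigcup (I : Type) (F : I -> set (config T)) :
  (forall i, config_open (F i)) -> config_open (\bigcup_i F i).
Proof. by move=> oF k; apply: bigcup_open => i _; exact: oF. Qed.

HB.instance Definition _ := isOpenTopological.Build (config T)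
  config_openT config_openI config_open_bigcup.

End ConfigTopology.

Section ConfigMeasurability.
Variable T : ptopologicalType.
Hypothesis hausT : hausdorff_space T.
Hypothesis scT : @second_countable T.

Definition tuple_row (k : nat) (t : k.-tuple T) : 'rV[T]_k :=
  \row_i tnth t i.

Lemma tuple_rowK k : cancel (@tuple_row k) (@row_tuple T k).
Proof.
by move=> t; apply/eq_from_tnth => i; rewrite tnth_mktuple mxE.
Qed.

Lemma nbhs_coord k (x : 'rV[T]_k) (i : 'I_k) (U : set T) :
  nbhs (x 0 i) U -> nbhs x [set y : 'rV[T]_k | U (y 0 i)].
Proof.
move=> xU; exists (fun _ j => if j == i then U else setT).
  by move=> i0 j; rewrite ord1; case: eqP => [->//|_]; exact: filterT.
by move=> y /= /(_ 0 i); rewrite eqxx.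
Qed.

Lemma offdiagP k (x : 'rV[T]_k) :
  offdiag x <-> forall i j : 'I_k, i != j -> x 0 i != x 0 j.
Proof.
split => [ux i j|xinj].
  apply: contra => /eqP xij; apply/eqP.
  have /tuple_uniqP tinj : uniq (row_tuple x) by exact: ux.
  apply: tinj; by rewrite !tnth_mktuple.
have /tuple_uniqP// : injective (tnth (row_tuple x)).
move=> i j; rewrite !tnth_mktuple => xij.
by apply/eqP; apply: contraT => /xinj; rewrite xij eqxx.
Qed.

Lemma open_offdiag k : open (@offdiag T k).
Proof.
rewrite openE => x /offdiagP ux.
suff H (i j : 'I_k) : i != j -> nbhs x [set y : 'rV[T]_k | y 0 i != y 0 j].
  pose S i j := [set y : 'rV[T]_k | i != j -> y 0 i != y 0 j].
  have nS i j : nbhs x (S i j).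
    have [ij|ij] := boolP (i != j); last first.
      by apply: filterS filterT => y _; rewrite /S /= (negbTE ij).
    by apply: filterS (H i j ij) => y yij _.
  have := @filter_forall _ _ _ _ (nbhs_filter x)
    (fun i => @filter_forall _ _ _ _ (nbhs_filter x) (nS i)).
  by apply: filterS => y Sy; apply/offdiagP => i j; exact: Sy.
move=> ij.
move: hausT; rewrite open_hausdorff => /(_ _ _ (ux _ _ ij))[[U V]] /= [Ui Vj].
move=> [oU oV /eqP UV0].
have nU : nbhs (x 0 i) U by apply: open_nbhs_nbhs; split => //; exact/set_mem.
have nV : nbhs (x 0 j) V by apply: open_nbhs_nbhs; split => //; exact/set_mem.
apply: filterS2 (nbhs_coord nU) (nbhs_coord nV) => y /= Uy Vy.
apply/eqP => yij; suff : (U `&` V) (y 0 i) by rewrite UV0.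
by split => //; rewrite yij.
Qed.

Lemma open_measurable_tuple k (U : set 'rV[T]_k) : open U ->
  measurable [set t : k.-tuple (borel T) | U (@tuple_row k t)].
Proof.
move=> oU; have [B cB [oB bB]] := scT.
have /countable_injP[e einj] := cB.
pose dec (p : nat) : set T := \bigcup_(V in [set V | B V /\ e V = p]) V.
have decE V : B V -> dec (e V) = V.
  move=> BV; rewrite /dec (_ : [set _ | _] = [set V]) ?bigcup_set1//.
  apply/seteqP; split => [W /= [BW eW]|W /= ->//].
  by apply: einj => //; rewrite inE.
have odec p : open (dec p) by apply: bigcup_open => V [BV _]; exact: oB.
pose box (f : {ffun 'I_k -> nat}) : set (k.-tuple (borel T)) :=
  \bigcap_(i in [set: 'I_k]) ((@tnth k (borel T))^~ i @^-1` dec (f i)).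
have mbox f : measurable (box f).
  apply: fin_bigcap_measurable => // i _.
  rewrite -[X in measurable X]setTI; apply: measurable_tnth => //.
  exact: sub_sigma_algebra.
rewrite (_ : [set t | _] = \bigcup_(f in [set f | box f `<=`
    [set t | U (@tuple_row k t)]]) box f); last first.
  apply/seteqP; split => [t /= Ut|t [f /= sf ft]]; last exact: sf.
  have : nbhs (@tuple_row k t) U by exact: open_nbhs_nbhs.
  case=> P tP PU.
  have hV (i : 'I_k) : exists V, [/\ B V, V (tnth t i) & V `<=` P 0 i].
    have := bB (tnth t i) (P 0 i); have := tP 0 i; rewrite mxE => tPi.
    by move=> /(_ tPi)[V [BV Vt] VP]; exists V.
  pose V i := sval (cid (hV i)).
  have VP i : [/\ B (V i), V i (tnth t i) & V i `<=` P 0 i].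
    exact: (svalP (cid (hV i))).
  have fE i : dec ([ffun i => e (V i)] i) = V i.
    by rewrite ffunE decE//; have [] := VP i.
  exists [ffun i => e (V i)].
    move=> s /= sV; apply: PU => i0 i; rewrite ord1 mxE.
    have [_ _] := VP i; apply; rewrite -fE; exact: sV.
  by move=> i _ /=; rewrite fE; have [] := VP i.
rewrite bigcup_mkcond; apply: countable_bigcupT_measurable => // f.
by case: ifP.
Qed.

(* The same set as [offdiag]: the product topology of [T^k] is carried by row
   vectors, its product sigma-algebra by tuples. *)
Definition distinct (k : nat) : set (k.-tuple (borel T)) :=
  [set t | uniq (t : k.-tuple T)].

Lemma offdiag_tuple_row k (t : k.-tuple T) :
  offdiag (tuple_row t) = @distinct k t.
Proof. by rewrite /offdiag /distinct /mkset tuple_rowK. Qed.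

Lemma measurable_distinct k : measurable (@distinct k).
Proof.
rewrite (_ : @distinct k = [set t | offdiag (@tuple_row k t)]).
  by apply: open_measurable_tuple; exact: open_offdiag.
by apply/seteqP; split => t; rewrite /= offdiag_tuple_row.
Qed.

Lemma measurable_config_of k (A : set (borel (config T))) : measurable A ->
  measurable (@distinct k `&` (@config_of T k @^-1` A)).
Proof.
pose D := @distinct k.
pose S : set (set (borel (config T))) :=
  [set A | measurable (D `&` (@config_of T k @^-1` A))].
suff sS : measurable `<=` S by exact: sS.
apply: smallest_sub.
  split.
  - by rewrite /S /= preimage_set0 setI0.
  - move=> B SB; rewrite /S /= setTD.
    rewrite (_ : _ `&` _ = D `\` (D `&` (@config_of T k @^-1` B))).
      by apply: measurableD => //; exact: measurable_distinct.
    by rewrite setDIr setDv set0U setDE preimage_setC.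
  - move=> F SF; rewrite /S /= preimage_bigcup setI_bigcupr.
    exact: bigcupT_measurable.
move=> B /(_ k)/open_subspaceP[V oV VB]; rewrite /S /=.
rewrite (_ : _ `&` _ = D `&` [set t | V (@tuple_row k t)]).
  by apply: measurableI; [exact: measurable_distinct|exact: open_measurable_tuple].
apply/seteqP; split => t [Dt /=]; have Ot : offdiag (@tuple_row k t).
- by rewrite offdiag_tuple_row.
- move=> Bt; split => //.
  have : ([set x | B (config_of (row_tuple x))] `&` @offdiag T k) (@tuple_row k t).
    by split => //=; rewrite tuple_rowK.
  by rewrite -VB => -[].
- by rewrite offdiag_tuple_row.
- move=> Vt; split => //.
  have : (V `&` @offdiag T k) (@tuple_row k t) by [].
  by rewrite VB => -[]/=; rewrite tuple_rowK.
Qed.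

End ConfigMeasurability.

Section LebesguePoisson.
Context {R : realType} {n : nat} {X : orientedRiemannian R n}.
Variable m : nonatomicRadon R X.

(* The image, under [config_of], of the restriction to [distinct] of the
   [k]-fold product of [m]. *)
Definition config_measure (k : nat) (A : set (borel (config X))) : \bar R :=
  tensor_power (radon m) k (@distinct X k `&` (@config_of X k @^-1` A)).

Section Measure.
Variable k : nat.

Let mconfig (A : set (borel (config X))) : measurable A ->
  measurable (@distinct X k `&` (@config_of X k @^-1` A)).
Proof.
move=> mA; apply: measurable_config_of => //.
  exact: carrier_hausdorff.
exact: carrier_second_countable.
Qed.

Let config_measure0 : config_measure k set0 = 0%E.
Proof. by rewrite /config_measure preimage_set0 setI0 measure0. Qed.

Let config_measure_ge0 A : (0 <= config_measure k A)%E.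
Proof. by rewrite /config_measure measure_ge0. Qed.

Let config_measure_sigma_additive : semi_sigma_additive (config_measure k).
Proof.
move=> F mF tF mUF; rewrite /config_measure preimage_bigcup setI_bigcupr.
apply: measure_semi_sigma_additive.
- by move=> i; exact: mconfig.
- apply/trivIsetP => i j _ _ ij.
  rewrite setIACA setIid -preimage_setI.
  by move/trivIsetP : tF => /(_ _ _ _ _ ij) -> //; rewrite preimage_set0 setI0.
- by rewrite -setI_bigcupr -preimage_bigcup; exact: mconfig.
Qed.

HB.instance Definition _ := isMeasure.Build _ _ _ (config_measure k)
  config_measure0 config_measure_ge0 config_measure_sigma_additive.

End Measure.

Definition lebesgue_poisson : {measure set (borel (config X)) -> \bar R} :=
  mseries (fun k => mscale (k`!%:R^-1)%:nng (config_measure k)) 0.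

End LebesguePoisson.

(* The elements of the spaces are represented by measurable functions;
   two functions represent the same element iff they are a.e. equal. *)

Section Spaces.
Context {R : realType} {n : nat} {X : orientedRiemannian R n}.
Variable m : nonatomicRadon R X.
Local Notation Gamma0 := (borel (config X)).
Local Notation lambda := (lebesgue_poisson m).
Implicit Types (C delta : R) (G H a : Gamma0 -> R) (eta xi : Gamma0).

Definition weight C delta eta : R :=
  C ^+ #|` eta | * ((#|` eta |)`!%:R `^ delta).

Definition K_space C delta : set (Gamma0 -> R) :=
  [set k : Gamma0 -> R | measurable_fun [set: Gamma0] k /\
    exists c, \forall eta \ae lambda, `|k eta| <= c * weight C delta eta].

Definition L_norm C delta G : \bar R :=
  (\int[lambda]_eta (`|G eta| * weight C delta eta)%:E)%E.

Definition L_space C delta : set (Gamma0 -> R) :=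
  [set G | measurable_fun [set: Gamma0] G /\ (L_norm C delta G < +oo)%E].

Definition conv G H : Gamma0 -> R :=
  fun eta => \sum_(xi <- fpowerset eta) G xi * H (eta `\` xi)%fset.

(* The unit of [conv], as [0 ^+ 0 = 1]. *)
Definition conv1 : Gamma0 -> R := fun eta => 0 ^+ #|` eta |.

Definition conv_exp a (k : nat) : Gamma0 -> R := iter k (conv a) conv1.

Definition union_integrand G a eta : Gamma0 -> R :=
  fun xi => G (eta `|` xi)%fset * a xi.

(* [Rintegral] is total, with a junk value on non-integrable functions; the
   convergence of the integral is therefore part of [dual_op_dom]. *)
Definition dual_op a G : Gamma0 -> R :=
  fun eta => \int[lambda]_xi union_integrand G a eta xi.

Definition dual_op_dom C delta a : set (Gamma0 -> R) :=
  [set G | [/\ L_space C delta G,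
      \forall eta \ae lambda,
        lambda.-integrable setT (EFin \o union_integrand G a eta) &
      L_space C delta (dual_op a G)]].

End Spaces.

(* [E] is a space of functions up to a.e. equality, with norm [N]. By
   linearity, a bounded operator maps a.e. equal functions to a.e. equal
   functions. *)

Section Resolvent.
Context {d : measure_display} {T : measurableType d} {R : realType}.
Variables (mu : {measure set T -> \bar R}) (E : set (T -> R)).
Variable N : (T -> R) -> \bar R.

Definition bounded_operator (B : (T -> R) -> (T -> R)) : Prop :=
  [/\ forall F, E F -> E (B F),
      forall (c : R) F G, E F -> E G ->
        \forall x \ae mu, B (fun y => c * F y + G y) x = c * B F x + B G x &
      exists M : R, forall F, E F -> (N (B F) <= M%:E * N F)%E].

(* [B] is the bounded inverse of [z - A], where [A] has domain [D]. *)
Definition is_resolvent (D : set (T -> R)) (A : (T -> R) -> (T -> R)) (z : R)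
    (B : (T -> R) -> (T -> R)) : Prop :=
  [/\ bounded_operator B,
      forall G, E G -> D (B G) /\
        \forall x \ae mu, z * B G x - A (B G) x = G x &
      forall F, D F -> \forall x \ae mu, B (fun y => z * F y - A F y) x = F x].

End Resolvent.

(* Main.v *)
Require Import Defs.
From mathcomp Require Import all_boot all_order all_algebra finmap.
From mathcomp Require Import all_classical all_reals all_analysis.
From mathcomp Require Import measurable_realfun ring.
Import Order.TTheory GRing.Theory Num.Theory.
Import numFieldNormedType.Exports.
Local Open Scope classical_set_scope.
Local Open Scope ring_scope.

(** Write [w] for the weight of [L_space m C delta] and [A] for the operator
[dual_op m a]. Everything rests on the Minlos identity [integral_subset_sum]:
for a nonnegative measurable [H], the double integral of [H xi zeta] against
the Lebesgue-Poisson measure is the integral over [eta] of the sum of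
[H xi (eta \ xi)] over the subsets [xi] of [eta].

Boundedness. Applied to [H eta xi = f (eta U xi) * (c * w_a xi) * w eta], where
[|a| <= c * w_a] almost everywhere, the identity bounds the weighted integral
of [eta |-> \int f (eta U xi) * |a xi|] by the integral of [f] against
[c * (w * w_a)], the star denoting the convolution. As [C > Ca] and
[delta >= da, 1], binomial coefficients raised to the power [1 - delta] are at
most 1 and a geometric series gives [w * w_a <= w / (1 - Ca / C)]
([conv_weight_le]). Hence [A] is defined on the whole space and bounded by some
[M] ([pairing_weight_le], [dual_op_bounded]).

Neumann series. Applied to [H xi zeta = G (eta U xi U zeta) * a xi * b zeta],
the identity says that pairing [G (eta U .)] with [a * b] amounts to pairing
first with [b], then with [a] ([pairing_conv]), so that the terms of the series
are the powers of [A] applied to [G]. Let [D] be the sum of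
[z^-(k+1) * \int |G (eta U xi)| * |a|^*k (xi)] over [k]. For [z > M] it has a
finite weighted integral, hence is finite almost everywhere
([integral_neumann_bound]). The rest of the computation takes place at a fixed
[eta] with [D eta] finite: the series converges there, [D] is a majorant for
exchanging [A] with the sum, and telescoping gives [z * B G - A (B G) = G] for
the sum [B G] ([neumann_series_resolvent]). As [M < z] makes [z - A] injective
([resolvent_injective]), the linearity of [B] and the identity
[B (z * F - A F) = F] follow.

The Minlos identity is proved on tuples. The integral against the
Lebesgue-Poisson measure is a series of integrals over the powers of [X], the
tuples with a repeated point being negligible since [m] is non-atomic
([integral_lebesgue_poisson]). The sum over the subsets of [x1, ..., xN] obeys
the recursion that puts [x1] either in the first or in the second set;
integrating it and using Pascal's rule gives the binomial formula
[integral_split_sum]. Measurability is obtained by lifting functions of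
configurations to tuples, which is legitimate because there are countably many
measurable sets on which the points of a configuration can be listed
measurably ([config_measurable_fun]). *)

Set Implicit Arguments.
Unset Strict Implicit.
Unset Printing Implicit Defensive.

(** * Sums over the subsets of a finite set *)

Section Combinatorics.
Variable T : choiceType.
Implicit Types (A : {fset T}) (s : seq T) (x : T).

(** The subsets of [x |` A] that contain [x] come first, then those that do not. *)
Lemma subset_sumU1 (V : nmodType) (F : {fset T} -> {fset T} -> V) A x :
    x \notin A ->
  \sum_(B <- fpowerset (x |` A)%fset) F B ((x |` A) `\` B)%fset =
  \sum_(B <- fpowerset A) (F (x |` B)%fset (A `\` B)%fset + F B (x |` (A `\` B))%fset).
Proof.
move=> xA.
have xB B : B \in fpowerset A -> x \notin B.
  by rewrite fpowersetE => /fsubsetP BA; apply: contra xA; exact: BA.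
have xU_inj : {in fpowerset A &, injective (fun B => (x |` B)%fset)}.
  move=> B C /xB xB' /xB xC' BC.
  by rewrite -[B](fsetU1K xB') BC fsetU1K.
rewrite (perm_big ([seq (x |` B)%fset | B <- fpowerset A] ++ fpowerset A)); last first.
  apply: uniq_perm; first exact: fset_uniq.
    rewrite cat_uniq fset_uniq andbT map_inj_in_uniq// fset_uniq/=.
    apply/hasPn => B /xB; apply: contra => /mapP[C _ ->].
    by rewrite fset1U1.
  move=> B; rewrite mem_cat !fpowersetE; apply/idP/orP.
    move=> BxA; have [xiB|xnB] := boolP (x \in B).
      left; apply/mapP; exists (B `\ x)%fset => /=; last by rewrite fsetD1K.
      rewrite fpowersetE; apply/fsubsetP => y; rewrite !inE => /andP[yx yB].
      by have /fsubsetP/(_ y yB) := BxA; rewrite !inE (negbTE yx).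
    right; apply/fsubsetP => y yB; have /fsubsetP/(_ y yB) := BxA.
    by rewrite !inE => /orP[/eqP yx|//]; rewrite -yx yB in xnB.
  case=> [/mapP[C /=]|BA].
    by rewrite fpowersetE => CA ->; exact: fsetUS.
  exact: fsubset_trans BA (fsubsetUr _ _).
rewrite big_cat big_map/= big_split/=; congr (_ + _); apply: eq_big_seq => B /[dup] + /xB xnB.
  rewrite fpowersetE => BA; congr F; apply/fsetP => y; rewrite !inE.
  by have [->/=|] := eqVneq y x; rewrite ?(negbTE xA) ?andbF// orbC.
move=> _; congr F; apply/fsetP => y; rewrite !inE.
by have [->/=|] := eqVneq y x; rewrite ?xnB.
Qed.

Lemma subset_sum0 (V : nmodType) (F : {fset T} -> {fset T} -> V) :
  \sum_(B <- fpowerset fset0) F B (fset0 `\` B)%fset = F fset0 fset0.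
Proof. by rewrite fpowerset0 big_seq_fset1 fsetDv. Qed.

(** The sum of [F B C] over the splittings of the points of [s] into two sets
    [B] and [C], by recursion: the first point goes to [B] or to [C]. It is the
    sum over the subsets when [s] has no repetition ([split_sumE]), but unlike
    the latter it is defined by the same formula on all tuples. *)
Fixpoint split_sum (V : nmodType) (F : {fset T} -> {fset T} -> V) s : V :=
  if s is x :: s' then
    split_sum (fun B C => F (x |` B)%fset C) s' +
    split_sum (fun B C => F B (x |` C)%fset) s'
  else F fset0 fset0.

Lemma config_of0 (t : 0.-tuple T) : config_of t = fset0.
Proof. by rewrite tuple0; apply/fsetP => y; rewrite !inE. Qed.

Lemma config_of_cons k x (t : k.-tuple T) (u : k.+1.-tuple T) :
  tval u = x :: t -> config_of u = (x |` config_of t)%fset.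
Proof. by move=> ut; apply/fsetP => y; rewrite !inE/= ut inE. Qed.

Lemma split_sumE (V : nmodType) (F : {fset T} -> {fset T} -> V) s : uniq s ->
  split_sum F s =
  \sum_(B <- fpowerset [fset y in s]%fset) F B ([fset y in s] `\` B)%fset.
Proof.
elim: s F => [F _|x s IH F /= /andP[xs us]].
  rewrite (_ : [fset y in [::]]%fset = fset0) ?subset_sum0//.
  by apply/fsetP => y; rewrite !inE.
rewrite (_ : [fset y in x :: s]%fset = (x |` [fset y in s])%fset); last first.
  by apply/fsetP => y; rewrite !inE.
rewrite subset_sumU1; last by rewrite !inE.
by rewrite !IH// big_split.
Qed.

End Combinatorics.

(** Pascal's rule, summed over the pairs [(j, n - j)]. *)
Lemma pascal_sum (V : nmodType) (u : nat -> nat -> V) n :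
  \sum_(j < n.+1) u j.+1 (n - j)%N *+ 'C(n, j) +
  \sum_(j < n.+1) u j (n - j).+1 *+ 'C(n, j) =
  \sum_(j < n.+2) u j (n.+1 - j)%N *+ 'C(n.+1, j).
Proof.
rewrite [RHS]big_ord_recl/= bin0 subn0.
under [X in _ = _ + X]eq_bigr => j _.
  rewrite /bump/= add1n subSS binS mulrnDr; over.
rewrite big_split/= [X in _ = _ + (X + _)]big_ord_recr/= bin_small// mulr0n addr0.
rewrite addrA addrC; congr (_ + _).
rewrite big_ord_recl/= bin0 subn0; congr (_ + _); apply: eq_bigr => j _.
by rewrite /bump/= add1n; congr (u _ _ *+ _); rewrite subnSK.
Qed.

Lemma subset_sum_card (T : choiceType) (V : nmodType) (u : nat -> nat -> V)
    (A : {fset T}) :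
  \sum_(B <- fpowerset A) u #|` B| #|` (A `\` B)%fset| =
  \sum_(j < #|` A|.+1) u j (#|` A| - j)%N *+ 'C(#|` A|, j).
Proof.
elim/fset1U_rect: A u => [|x A xA IH] u.
  by rewrite (subset_sum0 (fun B C : {fset T} => u #|` B| #|` C|)) cardfs0 big_ord1.
rewrite (subset_sumU1 (fun B C : {fset T} => u #|` B| #|` C|))// cardfsU1 xA add1n -pascal_sum.
rewrite -(IH (fun j k => u j.+1 k)) -(IH (fun j k => u j k.+1)) -big_split/=.
apply: eq_big_seq => B; rewrite fpowersetE => /fsubsetP BA.
have xB : x \notin B by apply: contra xA; exact: BA.
by rewrite !cardfsU1 xB !inE (negbTE xA) andbF.
Qed.

(** * Convolution of weights *)

Section WeightBound.
Variables (R : realType) (Ca da C delta : R).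
Hypotheses (Ca_gt0 : 0 < Ca) (CaC : Ca < C).
Hypothesis delta_ge : Num.max da 1 <= delta.

Let q := Ca / C.
(** The constant [1 / (1 - Ca / C)] such that the convolution of the weights of
    parameters [(C, delta)] and [(Ca, da)] is at most this constant times the
    first one ([binomial_weight_le]). *)
Definition conv_bound : R := (1 - q)^-1.

Let C_gt0 : 0 < C. Proof. exact: lt_trans CaC. Qed.
Let q_ge0 : 0 <= q. Proof. by rewrite divr_ge0// ltW. Qed.
Let q_lt1 : q < 1. Proof. by rewrite ltr_pdivrMr// mul1r. Qed.

Lemma conv_bound_ge0 : 0 <= conv_bound.
Proof. by rewrite invr_ge0 subr_ge0 ltW. Qed.

(** As [(j + k)!] is the product of [j!], [k!] and a binomial coefficient, this
    holds because the latter is at most its power of exponent [delta], [delta]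
    being at least 1, and because [da <= delta]. *)
Lemma fact_powR_le (j k : nat) :
  (j`!%:R `^ delta) * (k`!%:R `^ da) *+ 'C(j + k, j) <= (j + k)`!%:R `^ delta.
Proof.
have /andP[dad d1] : (da <= delta) && (1 <= delta) by rewrite -ge_max.
have f1 n : 1 <= n`!%:R :> R by rewrite ler1n fact_gt0.
have b1 : 1 <= 'C(j + k, j)%:R :> R by rewrite ler1n bin_gt0 leq_addr.
have -> : (j + k)`!%:R = 'C(j + k, j)%:R * (j`!%:R * k`!%:R) :> R.
  by rewrite -!natrM -(bin_fact (leq_addr k j)) addKn.
rewrite -mulr_natl !powRM ?mulr_ge0 ?ler0n//.
apply: ler_pM; rewrite ?ler0n ?mulr_ge0 ?powR_ge0//.
  rewrite -[leLHS](powRr1 (le_trans ler01 b1)).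
  exact: ler_powR.
by rewrite ler_wpM2l ?powR_ge0// ler_powR.
Qed.

Lemma binomial_weight_le n :
  \sum_(j < n.+1) (C ^+ j * j`!%:R `^ delta) * (Ca ^+ (n - j) * (n - j)`!%:R `^ da)
     *+ 'C(n, j) <= conv_bound * (C ^+ n * n`!%:R `^ delta).
Proof.
have -> : conv_bound * (C ^+ n * n`!%:R `^ delta) =
   (C ^+ n * n`!%:R `^ delta) * conv_bound by rewrite mulrC.
apply: (@le_trans _ _ ((C ^+ n * n`!%:R `^ delta) * \sum_(j < n.+1) q ^+ (n - j))).
  rewrite mulr_sumr; apply: ler_sum => /= -[j /= jn] _.
  have -> : C ^+ n = C ^+ j * C ^+ (n - j) by rewrite -exprD subnKC.
  have := fact_powR_le j (n - j); rewrite subnKC// => h.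
  rewrite /q expr_div_n.
  rewrite [leRHS](_ : _ = C ^+ j * Ca ^+ (n - j) * n`!%:R `^ delta); last first.
    have : C ^+ (n - j) != 0 by rewrite expf_neq0// gt_eqF.
    by move=> h'; field.
  apply: le_trans (ler_wpM2l _ h); last first.
    by rewrite mulr_ge0// exprn_ge0// ltW.
  by rewrite mulrACA mulrnAr lexx.
apply: ler_wpM2l; first by rewrite mulr_ge0 ?powR_ge0// exprn_ge0// ltW.
rewrite /conv_bound -[leRHS]mul1r ler_pdivlMr ?subr_gt0//.
(* the geometric sum of ratio [Ca / C] *)
rewrite (reindex_inj rev_ord_inj)/=.
under eq_bigr => j _ do rewrite subSS subKn// -1?ltnS//.
have -> : (\sum_(j < n.+1) q ^+ j) * (1 - q) = 1 - q ^+ n.+1.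
  by rewrite -[X in _ = X - _](expr1n _ n.+1) subrXX mulrC; congr (_ * _);
     apply: eq_bigr => j _; rewrite expr1n mul1r.
by rewrite lerBlDr lerDl exprn_ge0.
Qed.

End WeightBound.

(** * Measurable listings of the points of a configuration *)

Section ConfigSections.
Variable T : ptopologicalType.
Hypothesis hausT : hausdorff_space T.
Hypothesis scT : @second_countable T.
Local Notation Gamma0 := (borel (config T)).

Lemma config_open_open (A : set (config T)) : config_open A -> open A.
Proof. exact. Qed.

(** The configurations that meet [U]. *)
Definition hits (U : set T) : set Gamma0 :=
  [set eta | exists2 x, x \in (eta : {fset T}) & U x].

Lemma measurable_hits (U : set T) : open U -> measurable (hits U).
Proof.
move=> oU; apply: sub_sigma_algebra; apply: config_open_open => k.
apply: open_subspaceW; rewrite openE => x /= [y].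
rewrite inE => /tnthP[i ->] Uxi.
rewrite tnth_mktuple in Uxi.
have nU : nbhs (x 0 i) U by exact: open_nbhs_nbhs.
apply: filterS (nbhs_coord nU) => z /= Uzi; exists (z 0 i) => //.
by rewrite inE; apply/tnthP; exists i; rewrite tnth_mktuple.
Qed.

Lemma card_config_of k (t : k.-tuple T) : uniq t -> #|` config_of t| = k.
Proof.
by move=> ut; rewrite card_fseq undup_id// size_tuple.
Qed.

Lemma measurable_card k : measurable [set eta : Gamma0 | #|` eta| = k].
Proof.
apply: sub_sigma_algebra; apply: config_open_open => k'; apply/open_subspaceP.
exists (if k == k' then setT else set0).
  by case: ifP => _; [exact: openT|exact: open0].
apply/seteqP; split => x [+ ox]; have := card_config_of ox => /= ->.
  by case: eqP => // ->.
by move=> <-; rewrite eqxx.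
Qed.

(** The [k]-point configurations that meet every [U i]; if the [U i] are
    disjoint, such a configuration has exactly one point in each of them. *)
Definition spread k (U : 'I_k -> set T) : set Gamma0 :=
  [set eta | #|` eta| = k] `&` \bigcap_i hits (U i).

Lemma measurable_spread k (U : 'I_k -> set T) :
  (forall i, open (U i)) -> measurable (spread U).
Proof.
move=> oU; apply: measurableI; first exact: measurable_card.
by apply: fin_bigcap_measurable => // i _; exact: measurable_hits.
Qed.

(** The listing of the points of a configuration of [spread U] in which the
    [i]-th point is the one in [U i]; outside [spread U] the value is arbitrary. *)
Definition label k (U : 'I_k -> set T) (eta : Gamma0) : k.-tuple (borel T) :=
  [tuple if `[< spread U eta >] then
     xget point [set x | x \in (eta : {fset T}) /\ U i x] else point | i < k].

Lemma labelP k (U : 'I_k -> set T) eta i : spread U eta ->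
  tnth (label U eta) i \in (eta : {fset T}) /\ U i (tnth (label U eta) i).
Proof.
move=> Ueta; rewrite tnth_mktuple asboolT//.
case: xgetP => [x -> //|]; have [_ /(_ i I)[x xeta Ux]] := Ueta.
by move=> h; exfalso; apply: (h x).
Qed.

Lemma label_uniq k (U : 'I_k -> set T) eta : trivIset setT U ->
  spread U eta -> uniq (label U eta).
Proof.
move=> tU Ueta; apply/tuple_uniqP => i j ij.
apply: contrapT => /eqP ineqj.
have [_ Ui] := labelP i Ueta; have [_ Uj] := labelP j Ueta.
by move/trivIsetP : tU => /(_ i j I I ineqj)/seteqP[+ _] => /(_ _ (conj Ui _)); apply; rewrite ij.
Qed.

Lemma labelK k (U : 'I_k -> set T) eta : trivIset setT U ->
  spread U eta -> config_of (label U eta : k.-tuple T) = eta.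
Proof.
move=> tU Ueta; apply/eqP; rewrite eqEfcard; apply/andP; split.
  apply/fsubsetP => x; rewrite inE => /tnthP[i ->].
  by have [] := labelP i Ueta.
by rewrite card_config_of ?label_uniq//; have [-> _] := Ueta.
Qed.

Lemma measurable_label k (U : 'I_k -> set T) : (forall i, open (U i)) ->
  trivIset setT U -> measurable_fun setT (label U).
Proof.
move=> oU tU; apply/measurable_fun_tnthP => i.
rewrite (_ : _ \o _ = fun eta => if `[< spread U eta >] then
    xget point [set x | x \in (eta : {fset T}) /\ U i x] else point); last first.
  by apply/funext => eta; rewrite /= tnth_mktuple.
have mU := measurable_spread oU.
apply: measurable_fun_if => //.
  apply: (measurable_fun_bool true); rewrite setTI.
  rewrite (_ : _ @^-1` _ = spread U)//.
  by apply/seteqP; split => eta /= /asboolP.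
rewrite setTI (_ : _ @^-1` _ = spread U); last first.
  by apply/seteqP; split => eta /= /asboolP.
apply: (@measurability _ _ Gamma0 (borel T) _ _ (@open T)) => // _ [V oV <-].
(* the only point of [eta] in [U i] is in [V] iff [eta] meets [U i `&` V] *)
rewrite (_ : _ `&` _ = spread U `&` hits (U i `&` V)).
  by apply: measurableI => //; apply: measurable_hits; exact: openI.
apply/seteqP; split => eta [Ueta] /=; rewrite -/(_ `&` _).
  have := labelP i Ueta; rewrite tnth_mktuple asboolT// => -[].
  by set y := xget _ _ => yeta Uy Vy; split => //; exists y.
move=> [x xeta [Ux Vx]]; split => //.
have := labelP i Ueta; rewrite tnth_mktuple asboolT// => -[_].
set y := xget _ _ => Uy; suff -> : y = x by [].
move: xeta; rewrite -{1}(labelK tU Ueta) inE => /tnthP[j xj].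
have [_] := labelP j Ueta; rewrite -xj => Ujx.
have ij : i = j.
  apply: contrapT => /eqP ij.
  by move/trivIsetP : tU => /(_ i j I I ij)/seteqP[+ _] => /(_ x); apply.
by rewrite xj -ij tnth_mktuple asboolT.
Qed.

(** A base indexed by [nat]: an index that codes no set of the given base stands
    for the empty set. *)
Lemma countable_base : exists D : nat -> set T, (forall p, open (D p)) /\
  forall x U, nbhs x U -> exists2 p, D p x & D p `<=` U.
Proof.
have [B cB [oB bB]] := scT.
have /countable_injP[e einj] := cB.
exists (fun p => \bigcup_(V in [set V | B V /\ e V = p]) V); split.
  by move=> p; apply: bigcup_open => V [BV _]; exact: oB.
move=> x U /bB[V [BV Vx] VU]; exists (e V); first by exists V.
move=> y [W [BW eW]]; suff -> : W = V by exact: VU.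
by apply: einj => //; rewrite inE.
Qed.

(** Distinct points of a Hausdorff space have pairwise disjoint neighbourhoods. *)
Lemma separated_points k (t : k.-tuple T) : uniq t ->
  exists2 V : 'I_k -> set T, (forall i, nbhs (tnth t i) (V i)) & trivIset setT V.
Proof.
move=> /tuple_uniqP tinj.
have sep (p : 'I_k * 'I_k) : exists AB : set T * set T, p.1 != p.2 ->
    [/\ nbhs (tnth t p.1) AB.1, nbhs (tnth t p.2) AB.2 & AB.1 `&` AB.2 = set0].
  have [->|pneq] := eqVneq p.1 p.2; first by exists (set0, set0).
  have tneq : tnth t p.1 != tnth t p.2 by apply: contra pneq => /eqP/tinj ->.
  move: hausT; rewrite open_hausdorff => /(_ _ _ tneq)[[A B]] /= [Ai Bj].
  move=> [oA oB /eqP AB0]; exists (A, B) => _; split => //=.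
  - by apply: open_nbhs_nbhs; split => //; exact/set_mem.
  - by apply: open_nbhs_nbhs; split => //; exact/set_mem.
have [S SP] := choice sep.
exists (fun i => [set x | forall j, i != j -> (S (i, j)).1 x /\ (S (j, i)).2 x]).
  move=> i; apply: filter_forall => j.
  have [ij|ij] := boolP (i != j); last by apply: filterS filterT => y _.
  have [Si _ _] := SP (i, j) ij.
  have ji : j != i by rewrite eq_sym.
  have [_ Si' _] := SP (j, i) ji.
  by apply: filterS2 Si Si' => y.
apply/trivIsetP => i j _ _ ij; apply/seteqP; split => // y [/(_ j ij)[yi _]].
have ji : j != i by rewrite eq_sym.
move=> /(_ i ji)[_ yj].
by have [_ _ /seteqP[+ _]] := SP (i, j) ij; exact.
Qed.

(** A function of a configuration, and of a parameter, is measurable if on the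
    tuples of distinct points it is given by measurable functions of the tuple.
    Indeed countably many sets [E p] cover the configurations, one for each
    finite sequence of disjoint sets of a countable base, and on [E p] the
    function is the composite of one of these with a measurable listing. *)
Lemma config_measurable_fun d d' (S : measurableType d) (Y : measurableType d')
    (f : S * Gamma0 -> Y) (g : forall k, S * k.-tuple (borel T) -> Y) :
  (forall k, measurable_fun setT (g k)) ->
  (forall k x (t : k.-tuple T), uniq t -> f (x, config_of t) = g k (x, t)) ->
  measurable_fun setT f.
Proof.
move=> mg fg; have [D [oD bD]] := countable_base.
pose U (s : seq nat) (i : 'I_(size s)) := D (nth 0%N s i).
pose E p : set Gamma0 := if (choice.unpickle p : option (seq nat)) is Some s then
   if `[< trivIset setT (U s) >] then spread (U s) else set0 else set0.
have mE p : measurable (E p).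
  rewrite /E; case: choice.unpickle => // s; case: ifP => // _.
  by apply: measurable_spread => i; exact: oD.
have -> : [set: S * Gamma0] = \bigcup_p (snd @^-1` E p).
  apply/seteqP; split => // -[x eta] _ /=.
  have ueta : uniq (in_tuple (enum_fset eta)) by exact: fset_uniq.
  have [V nV tV] := separated_points ueta.
  have /choice[p pP] : forall i, exists p,
      D p (tnth (in_tuple (enum_fset eta)) i) /\ D p `<=` V i.
    by move=> i; have [p Dp DV] := bD _ _ (nV i); exists p.
  pose s := [tuple p i | i < size eta].
  have sz : size s = size eta by rewrite size_tuple.
  exists (choice.pickle (s : seq nat)) => //.
  suff : E (choice.pickle (s : seq nat)) eta by [].
  rewrite /E choice.pickleK.
  have Us i : U s i = D (p (cast_ord sz i)).
    by rewrite /U -(tnth_mktuple p) (tnth_nth 0%N).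
  rewrite asboolT; last first.
    apply/trivIsetP => i j _ _ ij; rewrite !Us; apply/seteqP; split => // y [yi yj].
    move/trivIsetP : tV => /(_ (cast_ord sz i) (cast_ord sz j) I I).
    rewrite (inj_eq (@cast_ord_inj _ _ _)) => /(_ ij)/seteqP[+ _] => /(_ y); apply.
    by split; [exact: (pP _).2|exact: (pP _).2].
  split => [|i _]; first by rewrite /= sz.
  exists (tnth (in_tuple (enum_fset eta)) (cast_ord sz i)).
    exact: mem_tnth.
  by rewrite Us; exact: (pP _).1.
apply/measurable_fun_bigcup => [p|p].
  by rewrite -[X in measurable X]setTI; exact: measurable_snd.
rewrite /E; case: (choice.unpickle p) => [s|]; last first.
  by rewrite preimage_set0; exact: measurable_fun_set0.
case: asboolP => tU; last by rewrite preimage_set0; exact: measurable_fun_set0.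
have mU := measurable_label (fun i => oD _) tU.
apply: (eq_measurable_fun (fun y => g _ (y.1, label (U s) y.2))).
  move=> [x eta]; rewrite inE /= => Ueta.
  by rewrite -fg ?labelK//; exact: label_uniq.
apply: measurable_funTS; apply: measurableT_comp; first exact: mg.
by apply: measurable_fun_pair => //; exact: measurableT_comp.
Qed.

End ConfigSections.

(** * Measurability of the operations on configurations *)

Section ConfigOperations.
Variable T : ptopologicalType.
Hypothesis hausT : hausdorff_space T.
Hypothesis scT : @second_countable T.
Local Notation Gamma0 := (borel (config T)).
Local Notation cfg t := (@config_of T _ t : Gamma0).
Local Notation tupleX k := (k.-tuple (borel T)).

(** The case without parameter. *)
Lemma config_measurable_fun1 d (Y : measurableType d) (f : Gamma0 -> Y)
    (g : forall k, tupleX k -> Y) :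
  (forall k, measurable_fun setT (g k)) ->
  (forall k (t : k.-tuple T), uniq t -> f (config_of t) = g k t) ->
  measurable_fun setT f.
Proof.
move=> mg fg.
have : measurable_fun setT (fun p : unit * Gamma0 => f p.2).
  apply: (config_measurable_fun hausT scT (g := fun k p => g k p.2)).
    by move=> k; exact: (measurableT_comp (mg k)).
  by move=> k x t ut; rewrite -fg.
by move=> /(measurable_fun_pair2 tt).
Qed.

Lemma measurable_uniq k :
  measurable_fun setT (fun t : tupleX k => uniq (t : k.-tuple T)).
Proof.
apply: (measurable_fun_bool true); rewrite setTI.
exact: (measurable_distinct hausT scT (k := k)).
Qed.

Let measurable_config_of_uniq k : measurable_fun setT
  (fun t : tupleX k => if uniq (t : k.-tuple T) then cfg t else fset0 : Gamma0).
Proof.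
apply: measurable_fun_if => //; first exact: measurable_uniq.
move=> _ A mA; rewrite setTI.
exact: (measurable_config_of hausT scT (k := k) mA).
Qed.

(** Adding the point [x] to the configuration of [t] gives the configuration of
    [x :: t] when [x] is not in [t], and leaves it unchanged otherwise. *)
Lemma measurable_fsetU1 :
  measurable_fun setT (fun p : borel T * Gamma0 => (p.1 |` p.2)%fset : Gamma0).
Proof.
pose g k (p : borel T * tupleX k) : Gamma0 :=
  if uniq (tcons p : k.+1.-tuple T) then
    (if uniq (tcons p : k.+1.-tuple T) then cfg (tcons p) else fset0)
  else if uniq (p.2 : k.-tuple T) then cfg p.2 else fset0.
apply: (config_measurable_fun hausT scT (g := g)).
  move=> k; apply: measurable_fun_ifT.
  - apply: (measurableT_comp (@measurable_uniq k.+1)).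
    exact: measurable_tcons.
  - apply: (measurableT_comp (@measurable_config_of_uniq k.+1)).
    exact: measurable_tcons.
  - exact: (measurableT_comp (@measurable_config_of_uniq k)).
move=> k x t ut; rewrite /g /= ut andbT.
have [xt|xt] := boolP (x \in t); last exact/esym/config_of_cons.
by apply/fsetP => y; rewrite !inE orb_idl// => /eqP ->.
Qed.

Lemma config_of_tcons k (t : tupleX k.+1) :
  cfg t =
  (thead t |` cfg [tuple of behead (t : k.+1.-tuple T)])%fset.
Proof. by apply: config_of_cons; rewrite {1}(tuple_eta t). Qed.

(** Measurability on all tuples, with repetitions or not: the points are added
    one at a time. *)
Lemma measurable_config_ofT k :
  measurable_fun setT (fun t : tupleX k => cfg t).
Proof.
elim: k => [|k IH].
  rewrite (_ : (fun t => _) = cst (fset0 : Gamma0))//.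
  by apply/funext => t; rewrite config_of0.
rewrite (_ : (fun t => _) = fun t : tupleX k.+1 =>
  (thead t |` cfg [tuple of behead (t : k.+1.-tuple T)])%fset : Gamma0).
  apply: (measurableT_comp measurable_fsetU1
    (g := fun t : tupleX k.+1 => (thead t, cfg [tuple of behead t]))).
  apply: measurable_fun_pair; first exact: measurable_tnth.
  apply: (measurableT_comp IH); exact: measurable_behead.
by apply/funext => t; exact: config_of_tcons.
Qed.

Lemma measurable_fsetU :
  measurable_fun setT (fun p : Gamma0 * Gamma0 => (p.1 `|` p.2)%fset : Gamma0).
Proof.
have mU k : measurable_fun setT
    (fun p : Gamma0 * tupleX k => (p.1 `|` cfg p.2)%fset : Gamma0).
  elim: k => [|k IH].
    rewrite (_ : (fun t => _) = fst)//.
    by apply/funext => p; rewrite config_of0 fsetU0.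
  rewrite (_ : (fun t => _) = fun p : Gamma0 * tupleX k.+1 =>
    (thead p.2 |` (p.1 `|` cfg [tuple of behead (p.2 : k.+1.-tuple T)]))%fset : Gamma0).
    apply: (measurableT_comp measurable_fsetU1 (g := fun p : Gamma0 * tupleX k.+1 =>
      (thead p.2, (p.1 `|` cfg [tuple of behead p.2])%fset : Gamma0))).
    apply: measurable_fun_pair.
      by apply: measurableT_comp => //; exact: measurable_tnth.
    apply: (measurableT_comp IH (g := fun p : Gamma0 * tupleX k.+1 =>
      (p.1, [tuple of behead p.2]))).
    apply: measurable_fun_pair => //.
    exact: (measurableT_comp (@measurable_behead _ (borel T) k)).
  by apply/funext => p; rewrite config_of_tcons fsetUCA.
exact: (config_measurable_fun hausT scT (g := fun k p => _) mU).
Qed.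

Lemma measurable_card_config d (Y : measurableType d) (f : nat -> Y) :
  measurable_fun setT (fun eta : Gamma0 => f #|` eta|).
Proof.
apply: (config_measurable_fun1 (g := fun k _ => f k)) => // k t ut.
by rewrite card_config_of.
Qed.

Section SubsetSum.
Variable R : realType.

(** The parameter space [S] is needed by the induction, which moves the first
    point of the tuple into it. *)
Lemma measurable_split_sum k d (S : measurableType d)
    (H : S -> Gamma0 -> Gamma0 -> \bar R) :
  measurable_fun setT (fun p : S * (Gamma0 * Gamma0) => H p.1 p.2.1 p.2.2) ->
  measurable_fun setT (fun p : S * tupleX k => split_sum (H p.1) p.2).
Proof.
elim: k d S H => [|k IH] d S H mH.
  rewrite (_ : (fun p => _) =
     fun p : S * tupleX 0 => H p.1 (fset0 : Gamma0) (fset0 : Gamma0)); last first.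
    by apply/funext => p; rewrite (tuple0 p.2).
  apply: (measurableT_comp mH
    (g := fun p : S * tupleX 0 => (p.1, (fset0 : Gamma0, fset0 : Gamma0)))).
  exact: measurable_fun_pair.
pose H1 (y : S * borel T) (xi zeta : Gamma0) := H y.1 (y.2 |` xi)%fset zeta.
pose H2 (y : S * borel T) (xi zeta : Gamma0) := H y.1 xi (y.2 |` zeta)%fset.
have mp : measurable_fun setT (fun p : S * tupleX k.+1 =>
    ((p.1, thead p.2), [tuple of behead p.2])).
  apply: measurable_fun_pair.
    apply: measurable_fun_pair => //.
    by apply: measurableT_comp => //; exact: measurable_tnth.
  exact: (measurableT_comp (@measurable_behead _ (borel T) k)).
rewrite (_ : (fun p => _) = fun p : S * tupleX k.+1 =>
    (split_sum (H1 (p.1, thead p.2)) [tuple of behead p.2] +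
     split_sum (H2 (p.1, thead p.2)) [tuple of behead p.2])%E); last first.
  by apply/funext => p; rewrite [in LHS](tuple_eta p.2).
apply: emeasurable_funD.
  apply: (measurableT_comp (IH _ _ H1 _) mp).
  apply: (measurableT_comp mH (g := fun p : (S * borel T) * (Gamma0 * Gamma0) =>
    (p.1.1, ((p.1.2 |` p.2.1)%fset : Gamma0, p.2.2)))).
  apply: measurable_fun_pair; first exact: measurableT_comp.
  apply: measurable_fun_pair; last exact: measurableT_comp.
  apply: (measurableT_comp measurable_fsetU1
    (g := fun p : (S * borel T) * (Gamma0 * Gamma0) => (p.1.2, p.2.1))).
  by apply: measurable_fun_pair; exact: measurableT_comp.
apply: (measurableT_comp (IH _ _ H2 _) mp).
apply: (measurableT_comp mH (g := fun p : (S * borel T) * (Gamma0 * Gamma0) =>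
  (p.1.1, (p.2.1, (p.1.2 |` p.2.2)%fset : Gamma0)))).
apply: measurable_fun_pair; first exact: measurableT_comp.
apply: measurable_fun_pair; first exact: measurableT_comp.
apply: (measurableT_comp measurable_fsetU1
  (g := fun p : (S * borel T) * (Gamma0 * Gamma0) => (p.1.2, p.2.2))).
by apply: measurable_fun_pair; exact: measurableT_comp.
Qed.

(** The sum over the subsets of a configuration; [Defs.conv G H] is the case of
    [fun xi zeta => G xi * H zeta]. *)
Definition subset_sum (H : Gamma0 -> Gamma0 -> \bar R) (eta : Gamma0) : \bar R :=
  (\sum_(xi <- fpowerset eta) H xi (eta `\` xi)%fset)%E.

Lemma subset_sum_config_of (H : Gamma0 -> Gamma0 -> \bar R) k (t : k.-tuple T) :
  uniq t -> subset_sum H (config_of t) = split_sum H t.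
Proof. by move=> ut; rewrite split_sumE. Qed.

Lemma measurable_subset_sum (H : Gamma0 -> Gamma0 -> \bar R) :
  measurable_fun setT (fun p : Gamma0 * Gamma0 => H p.1 p.2) ->
  measurable_fun setT (subset_sum H).
Proof.
move=> mH; apply: (config_measurable_fun1 (g := fun k t => split_sum H t)).
  move=> k; have : measurable_fun setT
      (fun p : unit * tupleX k => split_sum H p.2).
    apply: (@measurable_split_sum k _ unit (fun _ => H)).
    exact: (measurableT_comp mH).
  by move=> /(measurable_fun_pair2 tt).
by move=> k t ut; exact: subset_sum_config_of.
Qed.

End SubsetSum.

End ConfigOperations.

Section RiemannianConfig.
Context {R : realType} {n : nat} {X : orientedRiemannian R n}.
Local Notation Gamma0 := (borel (config X)).
Let hausX := @carrier_hausdorff R n X.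
Let scX := @carrier_second_countable R n X.

Lemma measurable_conv (G H : Gamma0 -> R) : measurable_fun [set: Gamma0] G ->
  measurable_fun [set: Gamma0] H -> measurable_fun [set: Gamma0] (Defs.conv G H).
Proof.
move=> mG mH; apply/measurable_EFinP.
rewrite (_ : EFin \o _ = subset_sum (fun xi zeta => (G xi * H zeta)%:E)).
  apply: (measurable_subset_sum hausX scX); apply/measurable_EFinP.
  by apply: measurable_funM; exact: measurableT_comp.
by apply/funext => eta; rewrite /Defs.conv /= -sumEFin.
Qed.

Lemma measurable_conv1 : measurable_fun [set: Gamma0] (@Defs.conv1 R n X).
Proof. exact: (measurable_card_config hausX scX (fun k => (0 : R) ^+ k)). Qed.

Lemma measurable_conv_exp (a : Gamma0 -> R) k : measurable_fun [set: Gamma0] a ->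
  measurable_fun [set: Gamma0] (conv_exp a k).
Proof.
move=> ma; elim: k => [|k IH]; first exact: measurable_conv1.
exact: measurable_conv.
Qed.

Lemma measurable_weight C delta :
  measurable_fun [set: Gamma0] (weight C delta : Gamma0 -> R).
Proof.
exact: (measurable_card_config hausX scX (fun k => C ^+ k * (k`!%:R `^ delta) : R)).
Qed.

Lemma measurable_union : measurable_fun setT
  (fun p : Gamma0 * Gamma0 => (p.1 `|` p.2)%fset : Gamma0).
Proof. exact: measurable_fsetU. Qed.

End RiemannianConfig.

(** * Integration against the Lebesgue-Poisson measure *)

Section TensorIntegral.
Local Open Scope ereal_scope.
Context d (T : measurableType d) (R : realType).
Variables (m : {sigma_finite_measure set T -> \bar R}) (k : nat).

(** Tonelli's theorem: the first point is integrated last. *)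
Lemma integral_tensor_power_cons (f : k.+1.-tuple T -> \bar R) :
  measurable_fun setT f -> (forall t, 0 <= f t) ->
  \int[tensor_power m k.+1]_t f t =
  \int[m]_x \int[tensor_power m k]_t f (tcons (x, t)).
Proof.
move=> mf f0.
transitivity (\int[pushforward (m \x tensor_power m k) (@tcons _ T k)]_t f t) => //.
rewrite ge0_integral_pushforward//; last exact: measurable_tcons.
rewrite preimage_setT fubini_tonelli1//.
  by apply: (measurableT_comp mf); exact: measurable_tcons.
by move=> x; exact: f0.
Qed.

End TensorIntegral.

Section ConfigIntegral.
Local Open Scope ereal_scope.
Context {R : realType} {n : nat} {X : orientedRiemannian R n}.
Variable m : nonatomicRadon R X.
Local Notation Gamma0 := (borel (config X)).
Local Notation lambda := (lebesgue_poisson m).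
Local Notation M k := (tensor_power (radon m) k).
Local Notation tupleX k := (k.-tuple (borel X)).
Local Notation cfg t := (@config_of X _ t : Gamma0).
Let hausX := @carrier_hausdorff R n X.
Let scX := @carrier_second_countable R n X.

Lemma setU1_seq (x : X) (s : seq X) :
  [set y | y \in x :: s] = [set x] `|` [set y | y \in s].
Proof.
apply/seteqP; split => z /=; rewrite inE.
  by move=> /orP[/eqP ->|zs]; [left|right].
by move=> [->|->]; rewrite ?eqxx ?orbT.
Qed.

Lemma measurable_point (x : X) : measurable ([set x] : set (borel X)).
Proof.
rewrite -[X in measurable X]setCK; apply: measurableC.
apply: sub_sigma_algebra; apply: closed_openC.
exact/accessible_closed_set1/hausdorff_accessible.
Qed.

Lemma measurable_seq (s : seq X) : measurable ([set x | x \in s] : set (borel X)).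
Proof.
elim: s => [|x s IH].
  by rewrite (_ : [set _ | _] = set0)//; apply/seteqP; split.
by rewrite setU1_seq; apply: measurableU => //; exact: measurable_point.
Qed.

Lemma radon_seq0 (s : seq X) : radon m [set x | x \in s] = 0.
Proof.
elim: s => [|x s IH].
  by rewrite (_ : [set _ | _] = set0) ?measure0//; apply/seteqP; split.
rewrite setU1_seq null_set_setU//.
- exact: measurable_point.
- exact: measurable_seq.
- exact: radon_nonatomic.
Qed.

(** By induction: when the other points are distinct, a repetition forces the
    first one into the finite set of the others, which is negligible. *)
Lemma tensor_power_distinct k : M k (~` @distinct X k) = 0.
Proof.
have mD j : measurable (@distinct X j) by exact: measurable_distinct.
elim: k => [|k IH].
  rewrite (_ : ~` _ = set0) ?measure0//; apply/seteqP; split => // t.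
  by rewrite /distinct/= (tuple0 t).
have mC : measurable (~` @distinct X k.+1) by exact: (measurableC (mD k.+1)).
have m1 : measurable_fun setT (fun t : tupleX k.+1 => (\1_(~` @distinct X k.+1) t : R)%:E).
  by apply/measurable_EFinP; exact: measurable_indic.
have -> : M k.+1 (~` @distinct X k.+1) =
    \int[M k.+1]_t (\1_(~` @distinct X k.+1) t : R)%:E.
  by rewrite integral_indic// setIT.
rewrite integral_tensor_power_cons//.
rewrite (fubini_tonelli (fun p : borel X * tupleX k =>
  (\1_(~` @distinct X k.+1) (tcons p) : R)%:E)) /=; first last.
- by move=> p; rewrite lee_fin.
- exact: (measurableT_comp m1 (@measurable_tcons _ (borel X) k)).
rewrite (ae_eq_integral (cst 0)) ?integral0//.
  apply: (measurable_fun_fubini_tonelli_G (fun p : borel X * tupleX k =>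
    (\1_(~` @distinct X k.+1) (tcons p) : R)%:E)).
    exact: (measurableT_comp m1 (@measurable_tcons _ (borel X) k)).
  by move=> p; rewrite lee_fin.
exists (~` @distinct X k); split => //; first exact: (measurableC (mD k)).
move=> t /=; apply: contra_not => ut _.
rewrite (_ : (fun x => _) = fun x : borel X => (\1_[set x | x \in (t : k.-tuple X)] x : R)%:E).
  rewrite integral_indic// ?setIT; first exact: radon_seq0.
  exact: measurable_seq.
apply/funext => x; rewrite !indicE; congr (_%:R%:E); congr nat_of_bool.
apply/idP/idP; rewrite !inE /=.
  by move=> /= /negP; rewrite /distinct /= ut andbT negbK.
by move=> xt; rewrite /distinct /= xt.
Qed.

(** The integrals are over all tuples, those with a repeated point being
    negligible. *)
Lemma integral_lebesgue_poisson (f : Gamma0 -> \bar R) :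
  measurable_fun setT f -> (forall eta, 0 <= f eta) ->
  \int[lambda]_eta f eta =
  \sum_(k <oo) (k`!%:R^-1)%:E * \int[M k]_t f (cfg t).
Proof.
move=> mf f0; rewrite ge0_integral_measure_series//.
apply: eq_eseriesr => k _; rewrite ge0_integral_mscale//=; congr (_ * _).
rewrite (eq_measure_integral (pushforward (M k) (fun t => cfg t))).
  exact: measurable_config_ofT.
move=> mcfg.
  rewrite ge0_integral_pushforward//; exact: measurable_config_ofT.
move=> mcfg A mA _; rewrite /config_measure /pushforward.
have mc : measurable ((fun t : tupleX k => cfg t) @^-1` A).
  by rewrite -[X in measurable X]setTI; exact: measurable_config_ofT.
have mD : measurable (@distinct X k) by exact: measurable_distinct.
rewrite [RHS](measureDI _ mc mD) setIC.
rewrite [X in X + _](_ : _ = 0) ?add0e//.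
apply: subset_measure0 (tensor_power_distinct k) => //.
- exact: (measurableD mc mD).
- exact: (measurableC mD).
Qed.

(** The integral of [H] over the pairs made of the configuration of a [j]-tuple
    and the configuration of a [k]-tuple. *)
Definition pair_integral (H : Gamma0 -> Gamma0 -> \bar R) j k : \bar R :=
  \int[M j]_s \int[M k]_t H (cfg s) (cfg t).

Lemma measurable_pair_integral_inner d (S : measurableType d) k
    (H : S -> Gamma0 -> \bar R) :
  measurable_fun setT (fun p : S * Gamma0 => H p.1 p.2) ->
  (forall x xi, 0 <= H x xi) ->
  measurable_fun setT (fun x => \int[M k]_t H x (cfg t)).
Proof.
move=> mH H0.
apply: (measurable_fun_fubini_tonelli_F (fun p : S * tupleX k => H p.1 (cfg p.2))).
  apply: (measurableT_comp mH (g := fun p : S * tupleX k => (p.1, cfg p.2))).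
  apply: measurable_fun_pair => //.
  exact: (measurableT_comp (measurable_config_ofT hausX scX (k := k))).
by move=> p; exact: H0.
Qed.

Lemma pair_integral_ge0 (H : Gamma0 -> Gamma0 -> \bar R) j k :
  (forall xi zeta, 0 <= H xi zeta) -> 0 <= pair_integral H j k.
Proof. by move=> H0; do 2 (apply: integral_ge0 => ? _). Qed.

Lemma cfg_tcons k x (t : tupleX k) : cfg (tcons (x, t)) = (x |` cfg t)%fset.
Proof. exact: config_of_cons. Qed.

Section PairRecursion.
Variable H : Gamma0 -> Gamma0 -> \bar R.
Hypothesis mH : measurable_fun setT (fun p : Gamma0 * Gamma0 => H p.1 p.2).
Hypothesis H0 : forall xi zeta, 0 <= H xi zeta.

Let mH1 : measurable_fun setT (fun p : borel X * (Gamma0 * Gamma0) =>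
  H (p.1 |` p.2.1)%fset p.2.2).
Proof.
apply: (measurableT_comp mH (g := fun p : borel X * (Gamma0 * Gamma0) =>
  ((p.1 |` p.2.1)%fset : Gamma0, p.2.2))).
apply: measurable_fun_pair; last exact: measurableT_comp.
apply: (measurableT_comp (measurable_fsetU1 hausX scX)
  (g := fun p : borel X * (Gamma0 * Gamma0) => (p.1, p.2.1))).
by apply: measurable_fun_pair => //; exact: measurableT_comp.
Qed.

Let mH2 : measurable_fun setT (fun p : borel X * (Gamma0 * Gamma0) =>
  H p.2.1 (p.1 |` p.2.2)%fset).
Proof.
apply: (measurableT_comp mH (g := fun p : borel X * (Gamma0 * Gamma0) =>
  (p.2.1, (p.1 |` p.2.2)%fset : Gamma0))).
apply: measurable_fun_pair; first exact: measurableT_comp.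
apply: (measurableT_comp (measurable_fsetU1 hausX scX)
  (g := fun p : borel X * (Gamma0 * Gamma0) => (p.1, p.2.2))).
by apply: measurable_fun_pair => //; exact: measurableT_comp.
Qed.

Let mI (F : borel X -> Gamma0 -> Gamma0 -> \bar R) j k :
  measurable_fun setT (fun p : borel X * (Gamma0 * Gamma0) => F p.1 p.2.1 p.2.2) ->
  (forall x xi zeta, 0 <= F x xi zeta) ->
  measurable_fun setT (fun x => pair_integral (F x) j k).
Proof.
move=> mF F0.
apply: (@measurable_pair_integral_inner _ _ _
  (fun x xi => \int[M k]_t F x xi (cfg t))); last first.
  by move=> x xi; exact: integral_ge0.
apply: (@measurable_pair_integral_inner _ (borel X * Gamma0)%type _
  (fun y zeta => F y.1 y.2 zeta)) => //.
apply: (measurableT_comp mF (g := fun p : (borel X * Gamma0) * Gamma0 =>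
  (p.1.1, (p.1.2, p.2)))).
apply: measurable_fun_pair; first exact: measurableT_comp.
by apply: measurable_fun_pair => //; exact: measurableT_comp.
Qed.

Lemma measurable_pair_integral1 j k :
  measurable_fun setT (fun x : borel X =>
    pair_integral (fun xi zeta => H (x |` xi)%fset zeta) j k).
Proof. by apply: mI. Qed.

Lemma measurable_pair_integral2 j k :
  measurable_fun setT (fun x : borel X =>
    pair_integral (fun xi zeta => H xi (x |` zeta)%fset) j k).
Proof. by apply: mI. Qed.

Let mH' k : measurable_fun setT (fun xi : Gamma0 => \int[M k]_t H xi (cfg t)).
Proof. exact: (measurable_pair_integral_inner _ mH). Qed.

(** Here and in [pair_integralS2], the additional point [x] becomes the first
    point of the first, respectively the second, tuple. *)
Lemma pair_integralS1 j k :
  \int[radon m]_x pair_integral (fun xi zeta => H (x |` xi)%fset zeta) j k =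
  pair_integral H j.+1 k.
Proof.
have mc := measurableT_comp (mH' k) (measurable_config_ofT hausX scX (k := j.+1)).
have c0 (s : tupleX j.+1) : 0 <= \int[M k]_t H (cfg s) (cfg t) by exact: integral_ge0.
apply/esym; rewrite /pair_integral.
apply: etrans (integral_tensor_power_cons (radon m) mc c0) _.
apply: eq_integral => x _; apply: eq_integral => s _ /=.
by apply: eq_integral => t _; rewrite cfg_tcons.
Qed.

Lemma pair_integralS2 j k :
  \int[radon m]_x pair_integral (fun xi zeta => H xi (x |` zeta)%fset) j k =
  pair_integral H j k.+1.
Proof.
rewrite /pair_integral (fubini_tonelli (fun p : borel X * tupleX j =>
    \int[M k]_t H (cfg p.2) (p.1 |` cfg t)%fset)) /=; first last.
- by move=> p; exact: integral_ge0.
- apply: (@measurable_pair_integral_inner _ (borel X * tupleX j)%type _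
    (fun y zeta => H (cfg y.2) (y.1 |` zeta)%fset)) => //.
  apply: (measurableT_comp mH2 (g := fun p : (borel X * tupleX j) * Gamma0 =>
    (p.1.1, (cfg p.1.2, p.2)))).
  apply: measurable_fun_pair; first exact: measurableT_comp.
  apply: measurable_fun_pair => //.
  apply: (measurableT_comp (measurable_config_ofT hausX scX (k := j))).
  exact: measurableT_comp.
apply: eq_integral => s _.
have mc := measurableT_comp (measurable_fun_pair2 (cfg s) mH)
  (measurable_config_ofT hausX scX (k := k.+1)).
have c0 (t : tupleX k.+1) : 0 <= H (cfg s) (cfg t) by [].
apply/esym; apply: etrans (integral_tensor_power_cons (radon m) mc c0) _.
apply: eq_integral => x _; apply: eq_integral => t _ /=.
by rewrite cfg_tcons.
Qed.

End PairRecursion.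

(** The binomial formula: by symmetry, only the number [j] of points put in the
    first set matters. The induction puts the first point in one of the two
    sets, and adds up the contributions by Pascal's rule. *)
Lemma integral_split_sum N (H : Gamma0 -> Gamma0 -> \bar R) :
  measurable_fun setT (fun p : Gamma0 * Gamma0 => H p.1 p.2) ->
  (forall xi zeta, 0 <= H xi zeta) ->
  \int[M N]_t split_sum H t =
  (\sum_(j < N.+1) pair_integral H j (N - j) *+ 'C(N, j))%R.
Proof.
elim: N H => [|N IH] H mH H0.
  rewrite big_ord1 /pair_integral bin0 mulr1n.
  have M0 (f : tupleX 0 -> \bar R) : \int[M 0%N]_t f t = f [tuple].
    rewrite (eq_integral (cst (f [tuple]))) => [|t _]; last by rewrite (tuple0 t).
    by rewrite integral_cst//= diracT mule1.
  by rewrite !M0 config_of0.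
pose H1 (x : borel X) (xi zeta : Gamma0) := H (x |` xi)%fset zeta.
pose H2 (x : borel X) (xi zeta : Gamma0) := H xi (x |` zeta)%fset.
have mins : measurable_fun setT
    (fun p : borel X * Gamma0 => (p.1 |` p.2)%fset : Gamma0).
  exact: (measurable_fsetU1 hausX scX).
have mH1 x : measurable_fun setT (fun p : Gamma0 * Gamma0 => H1 x p.1 p.2).
  apply: (measurableT_comp mH (g := fun p : Gamma0 * Gamma0 =>
    ((x |` p.1)%fset : Gamma0, p.2))).
  apply: measurable_fun_pair => //.
  exact: (measurableT_comp (measurable_fun_pair2 x mins)).
have mH2 x : measurable_fun setT (fun p : Gamma0 * Gamma0 => H2 x p.1 p.2).
  apply: (measurableT_comp mH (g := fun p : Gamma0 * Gamma0 =>
    (p.1, (x |` p.2)%fset : Gamma0))).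
  apply: measurable_fun_pair => //.
  exact: (measurableT_comp (measurable_fun_pair2 x mins)).
have msplit k (F : Gamma0 -> Gamma0 -> \bar R) :
    measurable_fun setT (fun p : Gamma0 * Gamma0 => F p.1 p.2) ->
    measurable_fun setT (fun t : tupleX k => split_sum F t).
  move=> mF; have := @measurable_split_sum _ hausX scX R k _ unit (fun _ => F).
  move=> /(_ (measurableT_comp mF measurable_snd)).
  by move=> /(measurable_fun_pair2 tt).
have split0 (F : Gamma0 -> Gamma0 -> \bar R) (s : seq X) :
    (forall xi zeta, 0 <= F xi zeta) -> 0 <= split_sum F s.
  by elim: s F => [|x s IHs] F F0 //=; apply: adde_ge0; exact: IHs.
rewrite integral_tensor_power_cons//; last 2 first.
- exact: (msplit _ _ mH).
- by move=> t; exact: split0.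
have sp1 x (t : tupleX N) : 0 <= split_sum (H1 x) t by apply: split0 => *; exact: H0.
have sp2 x (t : tupleX N) : 0 <= split_sum (H2 x) t by apply: split0 => *; exact: H0.
have mnat (x : \bar R) j : (x *+ j)%R = j%:R%:E * x by rewrite mule_natl.
rewrite -pascal_sum.
transitivity (\int[radon m]_x
   ((\sum_(j < N.+1) pair_integral (H1 x) j (N - j) *+ 'C(N, j))%R +
    (\sum_(j < N.+1) pair_integral (H2 x) j (N - j) *+ 'C(N, j))%R)).
  apply: eq_integral => x _.
  apply: etrans (f_equal2 +%E (IH (H1 x) (mH1 x) (fun _ _ => H0 _ _))
    (IH (H2 x) (mH2 x) (fun _ _ => H0 _ _))).
  exact: (ge0_integralD _ measurableT (fun t _ => sp1 x t) (msplit _ _ (mH1 x))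
    (fun t _ => sp2 x t) (msplit _ _ (mH2 x))).
have sum_int (F : borel X -> nat -> nat -> \bar R) :
    (forall j k, measurable_fun setT (fun x => F x j k)) ->
    (forall x j k, 0 <= F x j k) ->
    \int[radon m]_x (\sum_(j < N.+1) F x j (N - j)%N *+ 'C(N, j))%R =
    (\sum_(j < N.+1) (\int[radon m]_x F x j (N - j)%N)%E *+ 'C(N, j))%R.
  move=> mF F0.
  under eq_integral => x _ do under eq_bigr => j _ do rewrite mnat.
  under [RHS]eq_bigr => j _ do rewrite mnat -ge0_integralZl//.
  apply: ge0_integral_sum => //.
    by move=> j; apply: measurable_funeM; exact: mF.
  by move=> j x _; apply: mule_ge0.
have msum (F : borel X -> nat -> nat -> \bar R) :
    (forall j k, measurable_fun setT (fun x => F x j k)) ->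
    measurable_fun setT (fun x => \sum_(j < N.+1) F x j (N - j)%N *+ 'C(N, j))%R.
  move=> mF; apply: emeasurable_sum => j.
  rewrite (_ : (fun x => _) = (fun x => 'C(N, j)%:R%:E * F x j (N - j)%N)).
    by apply: measurable_funeM.
  by apply/funext => x; rewrite mnat.
have mP1 j k := measurable_pair_integral1 mH H0 j k.
have mP2 j k := measurable_pair_integral2 mH H0 j k.
have P10 x j k : 0 <= pair_integral (H1 x) j k.
  by apply: pair_integral_ge0 => *; exact: H0.
have P20 x j k : 0 <= pair_integral (H2 x) j k.
  by apply: pair_integral_ge0 => *; exact: H0.
have sum0 (F : borel X -> nat -> nat -> \bar R) x :
    (forall x j k, 0 <= F x j k) ->
    0 <= (\sum_(j < N.+1) F x j (N - j)%N *+ 'C(N, j))%R.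
  by move=> F0; apply: sume_ge0 => j _; rewrite mnat mule_ge0 ?lee_fin.
apply: etrans (ge0_integralD (radon m) measurableT
  (fun x _ => sum0 _ x P10) (msum _ mP1) (fun x _ => sum0 _ x P20) (msum _ mP2)) _.
apply: etrans (f_equal2 +%E (sum_int _ mP1 P10) (sum_int _ mP2 P20)) _.
congr (_ + _); apply: eq_bigr => j _; congr (_ *+ _)%R.
  exact: pair_integralS1.
exact: pair_integralS2.
Qed.

End ConfigIntegral.

(** * The Minlos identity *)

Section DiagonalSeries.
Local Open Scope ereal_scope.
Variable R : realType.

(** Summation of a nonnegative double series along the antidiagonals. *)
Lemma nneseries_antidiagonal (b : nat -> nat -> \bar R) :
  (forall j k, 0 <= b j k) ->
  \sum_(N <oo) (\sum_(j < N.+1) b j (N - j)%N) = \sum_(j <oo) \sum_(k <oo) b j k.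
Proof.
move=> b0; pose c N j := if (j <= N)%N then b j (N - j)%N else 0.
have c0 N j : 0 <= c N j by rewrite /c; case: ifP.
transitivity (\sum_(N <oo) \sum_(j <oo) c N j).
  apply: eq_eseriesr => N _.
  rewrite (nneseries_split 0 N.+1)//= add0n [X in _ + X]eseries0 ?adde0.
    rewrite big_mkord; apply: eq_bigr => -[j /= jN] _.
    by rewrite /c -ltnS jN.
  by move=> j Nj _; rewrite /c leqNgt Nj.
rewrite nneseries_interchange//; apply: eq_eseriesr => j _.
rewrite (nneseries_split 0 j)//= add0n big1_seq ?add0e.
  rewrite -nneseries_addn//; apply: eq_eseriesr => k _.
  by rewrite /c leq_addl addnK.
by move=> N /=; rewrite mem_index_iota /c => Nj; rewrite leqNgt; case/andP: Nj => _ ->.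
Qed.

End DiagonalSeries.

Section Minlos.
Local Open Scope ereal_scope.
Context {R : realType} {n : nat} {X : orientedRiemannian R n}.
Variable m : nonatomicRadon R X.
Local Notation Gamma0 := (borel (config X)).
Local Notation lambda := (lebesgue_poisson m).
Local Notation M k := (tensor_power (radon m) k).
Local Notation tupleX k := (k.-tuple (borel X)).
Local Notation cfg t := (@config_of X _ t : Gamma0).
Let hausX := @carrier_hausdorff R n X.
Let scX := @carrier_second_countable R n X.

Let c k : \bar R := (k`!%:R^-1)%:E.
Let c0 k : 0 <= c k. Proof. by rewrite lee_fin invr_ge0. Qed.

Lemma measurable_integral_lebesgue_poisson d (S : measurableType d)
    (H : S -> Gamma0 -> \bar R) :
  measurable_fun setT (fun p : S * Gamma0 => H p.1 p.2) ->
  (forall x xi, 0 <= H x xi) ->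
  measurable_fun setT (fun x => \int[lambda]_xi H x xi).
Proof.
move=> mH H0.
rewrite (_ : (fun x => _) = (fun x => \sum_(k <oo) c k * \int[M k]_t H x (cfg t))).
  apply: ge0_emeasurable_sum => k.
    by move=> x _ _; apply: mule_ge0 => //; exact: integral_ge0.
  move=> _; apply: measurable_funeM.
  exact: (measurable_pair_integral_inner m k mH H0).
apply/funext => x; rewrite integral_lebesgue_poisson//.
exact: (measurable_fun_pair2 x mH).
Qed.

Variable H : Gamma0 -> Gamma0 -> \bar R.
Hypothesis mH : measurable_fun setT (fun p : Gamma0 * Gamma0 => H p.1 p.2).
Hypothesis H0 : forall xi zeta, 0 <= H xi zeta.

(** The two functions agree on the tuples of distinct points, hence almost
    everywhere. *)
Lemma integral_subset_sum_tensor N :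
  \int[M N]_t subset_sum H (cfg t) = \int[M N]_t split_sum H t.
Proof.
have mS := measurable_subset_sum hausX scX mH.
apply: ae_eq_integral => //.
- exact: (measurableT_comp mS (measurable_config_ofT hausX scX (k := N))).
- have := @measurable_split_sum _ hausX scX R N _ unit (fun _ => H).
  move=> /(_ (measurableT_comp mH measurable_snd)).
  by move=> /(measurable_fun_pair2 tt).
- exists (~` @distinct X N); split.
  + exact: (measurableC (measurable_distinct hausX scX (k := N))).
  + exact: tensor_power_distinct.
  + by move=> t /=; apply: contra_not => ut _; exact: subset_sum_config_of.
Qed.

(** The Minlos identity, from the binomial formula for each number of points and
    [1 / N! * 'C(N, j) = 1 / j! * 1 / (N - j)!]. *)
Lemma integral_subset_sum :
  \int[lambda]_xi \int[lambda]_zeta H xi zeta = \int[lambda]_eta subset_sum H eta.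
Proof.
have mS := measurable_subset_sum hausX scX mH.
have P0 j k := pair_integral_ge0 m j k H0.
have mI k := measurable_pair_integral_inner m k mH H0.
rewrite [RHS]integral_lebesgue_poisson//; last first.
  by move=> eta; apply: sume_ge0.
rewrite integral_lebesgue_poisson; last 2 first.
- exact: measurable_integral_lebesgue_poisson.
- by move=> xi; exact: integral_ge0.
transitivity (\sum_(j <oo) \sum_(k <oo) (c j * c k) * pair_integral m H j k).
  apply: eq_eseriesr => j _.
  transitivity (c j * \sum_(k <oo) c k * pair_integral m H j k).
    congr (_ * _).
    transitivity (\int[M j]_s \sum_(k <oo) c k * \int[M k]_t H (cfg s) (cfg t)).
      apply: eq_integral => s _; rewrite integral_lebesgue_poisson//.
      exact: (measurable_fun_pair2 (cfg s) mH).
    have mIs k : measurable_fun setT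
        (fun s : tupleX j => \int[M k]_t H (cfg s) (cfg t)).
      exact: (measurableT_comp (mI k) (measurable_config_ofT hausX scX (k := j))).
    rewrite integral_nneseries//.
    - apply: eq_eseriesr => k _; rewrite ge0_integralZl// => s _.
      exact: integral_ge0.
    - by move=> k; exact: measurable_funeM.
    - by move=> k s _; apply: mule_ge0 => //; exact: integral_ge0.
  rewrite -nneseriesZl; last by move=> k _; exact: mule_ge0.
  by apply: eq_eseriesr => k _; rewrite muleA.
rewrite -nneseries_antidiagonal; last first.
  by move=> j k; do 2 apply: mule_ge0 => //.
apply: eq_eseriesr => N _.
rewrite integral_subset_sum_tensor; apply/esym.
have mnat (x : \bar R) j : (x *+ j)%R = j%:R%:E * x by rewrite mule_natl.
transitivity (c N * \sum_(j < N.+1) 'C(N, j)%:R%:E * pair_integral m H j (N - j)).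
  congr (_ * _).
  apply: etrans (integral_split_sum m N mH H0) _.
  by apply: eq_bigr => j _; rewrite mnat.
rewrite ge0_sume_distrr; last by move=> j _; apply: mule_ge0.
apply: eq_bigr => -[j /=]; rewrite ltnS => jN _.
rewrite muleA; congr (_ * _).
rewrite /c -!EFinM; congr EFin; rewrite -(bin_fact jN) !natrM.
have f0 i : (i`!%:R != 0 :> R)%R by rewrite pnatr_eq0 -lt0n fact_gt0.
have b0 : ('C(N, j)%:R != 0 :> R)%R by rewrite pnatr_eq0 -lt0n bin_gt0.
by field; rewrite ?f0 ?b0.
Qed.

End Minlos.

(** * Weighted integrals of pairings *)

Section Pairing.
Local Open Scope ereal_scope.
Context {R : realType} {n : nat} {X : orientedRiemannian R n}.
Variable m : nonatomicRadon R X.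
Local Notation Gamma0 := (borel (config X)).
Local Notation lambda := (lebesgue_poisson m).
Implicit Types (f : Gamma0 -> \bar R) (F G a b : Gamma0 -> R) (eta xi zeta : Gamma0).
Let hausX := @carrier_hausdorff R n X.
Let scX := @carrier_second_countable R n X.

(** The integral of [f (eta `|` xi) * b xi] over [xi], for nonnegative [f] and
    [b]. It may be infinite; [dual_op] is its analogue for real-valued data. *)
Definition pairing f b eta : \bar R :=
  \int[lambda]_xi (f (eta `|` xi)%fset * (b xi)%:E).

Lemma measurable_union_fun d (Y : measurableType d) (f : Gamma0 -> Y) :
  measurable_fun setT f ->
  measurable_fun setT (fun p : Gamma0 * Gamma0 => f (p.1 `|` p.2)%fset).
Proof. by move=> mf; exact: (measurableT_comp mf measurable_union). Qed.

Lemma measurable_unionl d (Y : measurableType d) (f : Gamma0 -> Y) eta :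
  measurable_fun setT f ->
  measurable_fun setT (fun xi : Gamma0 => f (eta `|` xi)%fset).
Proof.
move=> mf; exact: (measurable_fun_pair2 eta (measurable_union_fun mf)).
Qed.

Lemma measurable_pairing_integrand f b :
  measurable_fun setT f -> measurable_fun [set: Gamma0] b ->
  measurable_fun setT
    (fun p : Gamma0 * Gamma0 => f (p.1 `|` p.2)%fset * (b p.2)%:E).
Proof.
move=> mf mb; apply: emeasurable_funM; first exact: measurable_union_fun.
by apply/measurable_EFinP; exact: (measurableT_comp mb).
Qed.

Lemma pairing_ge0 f b eta : (forall xi, 0 <= f xi) -> (forall xi, (0 <= b xi)%R) ->
  0 <= pairing f b eta.
Proof.
by move=> f0 b0; apply: integral_ge0 => xi _; apply: mule_ge0; rewrite ?lee_fin.
Qed.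

Lemma measurable_pairing f b :
  measurable_fun setT f -> (forall xi, 0 <= f xi) ->
  measurable_fun [set: Gamma0] b -> (forall xi, (0 <= b xi)%R) ->
  measurable_fun setT (pairing f b).
Proof.
move=> mf f0 mb b0; apply: (measurable_integral_lebesgue_poisson m
  (H := fun eta xi => f (eta `|` xi)%fset * (b xi)%:E)).
  exact: measurable_pairing_integrand.
by move=> eta xi; apply: mule_ge0; rewrite ?lee_fin.
Qed.

Lemma fsetU_fpowerset eta xi : xi \in fpowerset eta -> (xi `|` (eta `\` xi))%fset = eta.
Proof.
rewrite fpowersetE => /fsubsetP xieta; apply/fsetP => y; rewrite !inE.
by have [/xieta ->|] := boolP (y \in xi).
Qed.

(** Pairing with a convolution is pairing with each of its factors in turn: the
    Minlos identity for [f (eta `|` xi `|` zeta) * c zeta * b xi]. *)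
Lemma pairing_conv f b (c : Gamma0 -> R) :
  measurable_fun setT f -> (forall xi, 0 <= f xi) ->
  measurable_fun [set: Gamma0] b -> (forall xi, (0 <= b xi)%R) ->
  measurable_fun [set: Gamma0] c -> (forall xi, (0 <= c xi)%R) ->
  pairing f (Defs.conv b c) =1 pairing (pairing f c) b.
Proof.
move=> mf f0 mb b0 mc c0 eta.
pose H xi zeta := (f (eta `|` (xi `|` zeta))%fset * (c zeta)%:E) * (b xi)%:E.
have H0 xi zeta : 0 <= H xi zeta by do 2 (apply: mule_ge0; rewrite ?lee_fin//).
have mH : measurable_fun setT (fun p : Gamma0 * Gamma0 => H p.1 p.2).
  apply: emeasurable_funM; last by apply/measurable_EFinP; exact: (measurableT_comp mb).
  apply: emeasurable_funM; last by apply/measurable_EFinP; exact: (measurableT_comp mc).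
  exact: (measurable_union_fun (measurable_unionl eta mf)).
transitivity (\int[lambda]_xi \int[lambda]_zeta H xi zeta); last first.
  apply: eq_integral => xi _; rewrite /H ge0_integralZr//.
  - by congr (_ * _); apply: eq_integral => zeta _; rewrite fsetUA.
  - apply: emeasurable_funM; last by apply/measurable_EFinP.
    exact: (measurable_fun_pair2 xi (measurable_union_fun (measurable_unionl eta mf))).
  - by move=> zeta _; apply: mule_ge0; rewrite ?lee_fin.
  - by rewrite lee_fin.
rewrite (integral_subset_sum m mH H0).
apply: eq_integral => xi _.
rewrite /Defs.conv -sumEFin ge0_sume_distrr; last first.
  by move=> zeta _; rewrite lee_fin mulr_ge0.
apply: eq_big_seq => zeta zxi; rewrite /H fsetU_fpowerset//.
by rewrite -muleA -EFinM mulrC.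
Qed.

Section Bound.
Variables (Ca da C delta : R) (a : Gamma0 -> R).
Hypotheses (Ca_gt0 : (0 < Ca)%R) (aK : K_space m Ca da a).
Hypotheses (CaC : (Ca < C)%R) (delta_ge : (Num.max da 1 <= delta)%R).

Lemma weight_ge0 (B d : R) eta : (0 <= B)%R -> (0 <= weight B d eta)%R.
Proof. by move=> B0; rewrite mulr_ge0 ?powR_ge0// exprn_ge0. Qed.

Lemma weight_gt0 (B d : R) eta : (0 < B)%R -> (0 < weight B d eta)%R.
Proof.
by move=> B0; rewrite mulr_gt0 ?exprn_gt0// powR_gt0// ltr0n fact_gt0.
Qed.

(** Both weights depend only on the number of points, so that this is
    [binomial_weight_le]. *)
Lemma conv_weight_le eta :
  (\sum_(xi <- fpowerset eta) weight C delta xi * weight Ca da (eta `\` xi)%fset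
   <= conv_bound Ca C * weight C delta eta)%R.
Proof.
have := binomial_weight_le Ca_gt0 CaC delta_ge #|` eta|.
by rewrite -(subset_sum_card (fun j k => (C ^+ j * (j`!%:R `^ delta) *
  (Ca ^+ k * (k`!%:R `^ da)))%R)).
Qed.

(** Pairing with [|a|] is bounded for the weighted integral. *)
Lemma pairing_weight_le : exists2 M : R, (0 <= M)%R & forall f,
  measurable_fun setT f -> (forall xi, 0 <= f xi) ->
  \int[lambda]_eta (pairing f (fun xi => `|a xi|)%R eta * (weight C delta eta)%:E) <=
  M%:E * \int[lambda]_eta (f eta * (weight C delta eta)%:E).
Proof.
have [ma [c ac]] := aK; have C0 : (0 < C)%R by exact: lt_trans CaC.
exists (`|c| * conv_bound Ca C)%R => [|f mf f0].
  by rewrite mulr_ge0//; exact: conv_bound_ge0.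
have w0 eta : (0 <= weight C delta eta)%R by exact/weight_ge0/ltW.
have wa0 eta : (0 <= weight Ca da eta)%R by exact/weight_ge0/ltW.
have mw := measurable_weight (X := X) C delta.
have mwa := measurable_weight (X := X) Ca da.
have mna : measurable_fun [set: Gamma0] (fun xi => `|a xi|)%R by exact: measurableT_comp.
pose H eta xi := f (eta `|` xi)%fset * (`|c| * weight Ca da xi * weight C delta eta)%:E.
have H0 eta xi : 0 <= H eta xi.
  have cw0 : (0 <= `|c| * weight Ca da xi * weight C delta eta)%R.
    by apply: mulr_ge0 => //; apply: mulr_ge0.
  by apply: mule_ge0; rewrite ?lee_fin.
have mH : measurable_fun setT (fun p : Gamma0 * Gamma0 => H p.1 p.2).
  apply: emeasurable_funM; first exact: measurable_union_fun.
  apply/measurable_EFinP; apply: measurable_funM.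
    by apply: measurable_funM => //; exact: (measurableT_comp mwa).
  exact: (measurableT_comp mw).
have mfw : measurable_fun setT (fun eta => f eta * (weight C delta eta)%:E).
  by apply: emeasurable_funM => //; apply/measurable_EFinP.
apply: (@le_trans _ _ (\int[lambda]_eta \int[lambda]_xi H eta xi)).
  apply: ge0_le_integral => //.
  - by move=> eta _; apply: mule_ge0; rewrite ?lee_fin// pairing_ge0.
  - apply: emeasurable_funM; last by apply/measurable_EFinP.
    exact: measurable_pairing.
  - exact: measurable_integral_lebesgue_poisson.
  move=> eta _; rewrite /pairing -ge0_integralZr//; last 3 first.
  - apply: emeasurable_funM; last by apply/measurable_EFinP.
    exact: measurable_unionl.
  - by move=> xi _; apply: mule_ge0; rewrite ?lee_fin.
  - by rewrite lee_fin.
  apply: ae_ge0_le_integral => //.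
  - by move=> xi _; apply: mule_ge0; rewrite ?lee_fin//; apply: mule_ge0; rewrite ?lee_fin.
  - apply: emeasurable_funM => //; apply: emeasurable_funM; last by apply/measurable_EFinP.
    exact: measurable_unionl.
  - exact: (measurable_fun_pair2 eta mH).
  (* the inner integral is the only place where [a] is bounded by its weight, so
     that a bound almost everywhere is enough *)
  apply: filterS ac => xi axi _; rewrite /H -muleA -EFinM.
  rewrite lee_wpmul2l// lee_fin ler_wpM2r//.
  by rewrite (le_trans axi)// ler_wpM2r// ler_norm.
(* in the sum over the subsets of [eta], the factor [f eta] is constant *)
rewrite (integral_subset_sum m mH H0) -ge0_integralZl//; last 2 first.
- by move=> eta _; apply: mule_ge0; rewrite ?lee_fin.
- by rewrite lee_fin mulr_ge0//; exact: conv_bound_ge0.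
apply: ge0_le_integral => //.
- by move=> eta _; apply: sume_ge0.
- exact: (measurable_subset_sum hausX scX mH).
- exact: measurable_funeM.
move=> eta _; rewrite /subset_sum.
rewrite (_ : \sum_(xi <- fpowerset eta) _ = f eta * (\sum_(xi <- fpowerset eta)
    `|c| * (weight C delta xi * weight Ca da (eta `\` xi)%fset))%R%:E); last first.
  rewrite -sumEFin ge0_sume_distrr; last by move=> xi _; rewrite lee_fin; do 2 apply: mulr_ge0 => //.
  apply: eq_big_seq => xi xieta; rewrite /H fsetU_fpowerset//.
  by rewrite -mulrA [X in (_ * X)%R]mulrC.
rewrite muleCA lee_wpmul2l// -mulr_sumr -EFinM lee_fin -mulrA ler_wpM2l//.
exact: conv_weight_le.
Qed.

End Bound.

End Pairing.

(** * The Minlos identity for signed functions *)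

Section RintegralGeneral.
Context d (T : measurableType d) (R : realType).
Variable mu : {measure set T -> \bar R}.
Implicit Types f : T -> R.

(** No integrability is needed: the real-valued integral of a non-integrable
    function is 0. *)
Lemma normr_Rintegral_le f : measurable_fun [set: T] f ->
  ((`|\int[mu]_x f x|)%:E <= \int[mu]_x (`|f x|)%:E)%E.
Proof.
move=> mf.
apply: (@le_trans _ _ (`| \int[mu]_x (f x)%:E |)%E).
  by rewrite /Rintegral; case: (\int[mu]_x _)%E => [r| |]//=; rewrite normr0 leey.
by apply: le_abse_integral => //; apply/measurable_EFinP.
Qed.

Lemma Rintegral_nonintegrable f : measurable_fun [set: T] f ->
  ~ mu.-integrable setT (EFin \o f) -> \int[mu]_x f x = 0.
Proof.
move=> mf nif; rewrite /Rintegral.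
have : ~~ ((\int[mu]_x (f x)%:E)%E \is a fin_num).
  rewrite -integral_fin_num_abs//; apply/negP => foo; apply: nif.
  by apply/integrableP; split => //; apply/measurable_EFinP.
by case: (\int[mu]_x _)%E.
Qed.

(** No integrability is needed: both sides vanish when [f] is not integrable. *)
Lemma RintegralZr_measurable f r : measurable_fun [set: T] f ->
  \int[mu]_x (f x * r) = (\int[mu]_x f x) * r.
Proof.
move=> mf; have [->|r0] := eqVneq r 0.
  rewrite mulr0 (_ : (fun x => _) = cst 0) ?Rintegral_cst// ?mul0r//.
  by apply/funext => x; rewrite mulr0.
have [fi|nfi] := pselect (mu.-integrable setT (EFin \o f)).
  exact: RintegralZr.
rewrite (Rintegral_nonintegrable mf nfi) mul0r; apply: Rintegral_nonintegrable.
  by apply: measurable_funM.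
move=> fri; apply: nfi.
have := integrableZr measurableT r^-1 fri; apply: eq_integrable => // x _ /=.
by rewrite -EFinM mulfK.
Qed.

Lemma integrable_le_abs f (g : T -> \bar R) : measurable_fun [set: T] f ->
  measurable_fun [set: T] g ->
  (forall x, (`|f x|)%:E <= g x)%E -> (\int[mu]_x g x < +oo)%E ->
  mu.-integrable setT (EFin \o f).
Proof.
move=> mf mg fg goo; apply/integrableP; split; first exact/measurable_EFinP.
apply: le_lt_trans goo; apply: ge0_le_integral => //=.
by apply/measurable_EFinP; exact: measurableT_comp.
Qed.

End RintegralGeneral.

Section SignedPairing.
Context {R : realType} {n : nat} {X : orientedRiemannian R n}.
Variable m : nonatomicRadon R X.
Local Notation Gamma0 := (borel (config X)).
Local Notation lambda := (lebesgue_poisson m).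
Implicit Types (F G a b : Gamma0 -> R) (eta xi zeta : Gamma0).
Let hausX := @carrier_hausdorff R n X.
Let scX := @carrier_second_countable R n X.

Lemma measurable_Rintegral_lebesgue_poisson d (S : measurableType d)
    (H : S -> Gamma0 -> R) :
  measurable_fun [set: S * Gamma0] (fun p : S * Gamma0 => H p.1 p.2) ->
  measurable_fun [set: S] (fun x => \int[lambda]_xi H x xi).
Proof.
move=> mH.
have mE : measurable_fun setT (fun p : S * Gamma0 => (H p.1 p.2)%:E).
  exact/measurable_EFinP.
apply: measurableT_comp => //.
under eq_fun do rewrite integralE.
apply: emeasurable_funB.
  apply: (measurable_integral_lebesgue_poisson m
    (H := fun x xi => ((fun xi' => (H x xi')%:E) ^\+ xi)%E)) => [|x xi //].
  rewrite (_ : (fun p => _) = (fun p : S * Gamma0 => (H p.1 p.2)%:E) ^\+)%E.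
    exact: measurable_funepos.
  by apply/funext => p; rewrite !funeposE.
apply: (measurable_integral_lebesgue_poisson m
  (H := fun x xi => ((fun xi' => (H x xi')%:E) ^\- xi)%E)) => [|x xi //].
rewrite (_ : (fun p => _) = (fun p : S * Gamma0 => (H p.1 p.2)%:E) ^\-)%E.
  exact: measurable_funeneg.
by apply/funext => p; rewrite !funenegE.
Qed.

(* [V] and [W] are the inner integral and the sum over the subsets; [p] and [q]
   are the positive and the negative part of [H]. *)
Section SignedSubsetSum.
Variable H : Gamma0 -> Gamma0 -> R.
Hypothesis mH : measurable_fun [set: Gamma0 * Gamma0]
  (fun p : Gamma0 * Gamma0 => H p.1 p.2).
Hypothesis Hoo : (\int[lambda]_xi \int[lambda]_zeta (`|H xi zeta|)%:E < +oo)%E.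

Let V xi := \int[lambda]_zeta H xi zeta.
Let W eta := \sum_(xi <- fpowerset eta) H xi (eta `\` xi)%fset.
Let p xi zeta := Num.max (H xi zeta) 0.
Let q xi zeta := (Num.max (- H xi zeta) 0 : R).

Let p0 xi zeta : 0 <= p xi zeta. Proof. by rewrite le_max lexx orbT. Qed.
Let q0 xi zeta : 0 <= q xi zeta. Proof. by rewrite le_max lexx orbT. Qed.
Let HE xi zeta : H xi zeta = p xi zeta - q xi zeta.
Proof.
rewrite /p /q; have [h|/ltW h] := leP 0 (H xi zeta).
  by rewrite max_r ?subr0// oppr_le0.
by rewrite max_l ?oppr_ge0// sub0r opprK.
Qed.
Let pH xi zeta : p xi zeta <= `|H xi zeta|.
Proof. by rewrite ge_max normr_ge0 ler_norm. Qed.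
Let qH xi zeta : q xi zeta <= `|H xi zeta|.
Proof. by rewrite ge_max normr_ge0 -normrN ler_norm. Qed.
Let mp : measurable_fun setT (fun u : Gamma0 * Gamma0 => (p u.1 u.2)%:E).
Proof. by apply/measurable_EFinP; exact: measurable_maxr. Qed.
Let mq : measurable_fun setT (fun u : Gamma0 * Gamma0 => (q u.1 u.2)%:E).
Proof.
apply/measurable_EFinP; apply: measurable_maxr => //.
exact: measurable_funN.
Qed.

Let mHn : measurable_fun setT (fun u : Gamma0 * Gamma0 => (`|H u.1 u.2|)%:E).
Proof. by apply/measurable_EFinP; exact: measurableT_comp. Qed.

(* The nonnegative function [r] stands for either of the two parts. *)
Section Part.
Variable r : Gamma0 -> Gamma0 -> R.
Hypothesis r0 : forall xi zeta, 0 <= r xi zeta.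
Hypothesis rH : forall xi zeta, r xi zeta <= `|H xi zeta|.
Hypothesis mr : measurable_fun setT (fun u : Gamma0 * Gamma0 => (r u.1 u.2)%:E).

Let J xi := (\int[lambda]_zeta (r xi zeta)%:E)%E.
Let mJ : measurable_fun setT J.
Proof.
by apply: (measurable_integral_lebesgue_poisson m (H := fun xi zeta => (r xi zeta)%:E)).
Qed.

Lemma integrable_inner_dominated : lambda.-integrable setT J.
Proof.
apply/integrableP; split => //.
apply: le_lt_trans Hoo; apply: ge0_le_integral => //.
- exact: measurableT_comp.
- exact: (measurable_integral_lebesgue_poisson m (H := fun xi zeta => (`|H xi zeta|)%:E)).
move=> xi _; rewrite gee0_abs; last by apply: integral_ge0 => zeta _; rewrite lee_fin.
apply: ge0_le_integral => //.
- by move=> zeta _; rewrite lee_fin.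
- exact: (measurable_fun_pair2 xi mr).
- exact: (measurable_fun_pair2 xi mHn).
- by move=> zeta _; rewrite lee_fin.
Qed.

Lemma integral_inner_dominated : (\int[lambda]_xi J xi =
  \int[lambda]_eta (\sum_(xi <- fpowerset eta) r xi (eta `\` xi)%fset)%:E)%E.
Proof.
rewrite (integral_subset_sum m mr); last by move=> *; rewrite lee_fin.
by apply: eq_integral => eta _; rewrite /subset_sum sumEFin.
Qed.

Lemma integrable_subset_dominated : lambda.-integrable setT
  (fun eta => (\sum_(xi <- fpowerset eta) r xi (eta `\` xi)%fset)%:E).
Proof.
apply/integrableP; split.
  rewrite (_ : (fun eta => _) = subset_sum (fun xi zeta => (r xi zeta)%:E)).
    exact: measurable_subset_sum.
  by apply/funext => eta; rewrite /subset_sum sumEFin.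
have := integrable_lty measurableT integrable_inner_dominated; rewrite integral_inner_dominated.
apply: le_lt_trans; rewrite le_eqVlt; apply/orP; left; apply/eqP.
apply: eq_integral => eta _; rewrite gee0_abs// lee_fin.
exact: sumr_ge0.
Qed.

End Part.

Lemma measurable_inner_Rintegral : measurable_fun [set: Gamma0] V.
Proof. exact: measurable_Rintegral_lebesgue_poisson. Qed.

Lemma integrable_inner_Rintegral : lambda.-integrable setT (EFin \o V).
Proof.
apply: integrable_le_abs Hoo.
- exact: measurable_inner_Rintegral.
- exact: (measurable_integral_lebesgue_poisson m (H := fun xi zeta => (`|H xi zeta|)%:E)).
- move=> xi; apply: normr_Rintegral_le.
  exact: (measurable_fun_pair2 xi mH).
Qed.

Let WE : (EFin \o W = (fun eta => (\sum_(xi <- fpowerset eta) p xi (eta `\` xi)%fset)%:E)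
  \- (fun eta => (\sum_(xi <- fpowerset eta) q xi (eta `\` xi)%fset)%:E))%E.
Proof.
apply/funext => eta; rewrite /= -EFinB -sumrB; congr EFin.
by apply: eq_bigr => xi _; exact: HE.
Qed.

Lemma integrable_subset_sum : lambda.-integrable setT (EFin \o W).
Proof.
by rewrite WE; apply: integrableB => //; exact: integrable_subset_dominated.
Qed.

(** The Minlos identity for an absolutely integrable [H], by subtracting the
    identities for its two parts. *)
Lemma Rintegral_subset_sum : \int[lambda]_xi V xi = \int[lambda]_eta W eta.
Proof.
rewrite /Rintegral; congr fine.
have ip := integrable_inner_dominated p0 pH mp; have iq := integrable_inner_dominated q0 qH mq.
transitivity (\int[lambda]_xi ((fun xi => \int[lambda]_zeta (p xi zeta)%:E) \-
    (fun xi => \int[lambda]_zeta (q xi zeta)%:E)) xi)%E; last first.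
  rewrite integralB// (integral_inner_dominated p0 mp) (integral_inner_dominated q0 mq) -integralB//.
  - by apply: eq_integral => eta _; exact: (esym (congr1 (@^~ eta) WE)).
  - exact: integrable_subset_dominated.
  - exact: integrable_subset_dominated.
apply: ae_eq_integral => //.
- apply/measurable_EFinP; exact: measurable_inner_Rintegral.
- by apply: measurable_int; apply: integrableB ip iq.
(* almost everywhere the inner integrals of both parts are finite, and then the
   integral of their difference is the difference of the integrals *)
apply: filterS2 (integrable_ae measurableT ip) (integrable_ae measurableT iq).
move=> xi /(_ I) pfin /(_ I) qfin _ /=.
have mpx := measurable_fun_pair2 xi mp; have mqx := measurable_fun_pair2 xi mq.
have ipx : lambda.-integrable setT (fun zeta => (p xi zeta)%:E).
  apply/integrableP; split => //; under eq_integral do rewrite gee0_abs ?lee_fin//.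
  by rewrite ltey_eq pfin.
have iqx : lambda.-integrable setT (fun zeta => (q xi zeta)%:E).
  apply/integrableP; split => //; under eq_integral do rewrite gee0_abs ?lee_fin//.
  by rewrite ltey_eq qfin.
rewrite -integralB// -[RHS]fineK; last first.
  by apply: integrable_fin_num => //; exact: integrableB.
by congr (fine _)%:E; apply: eq_integral => zeta _ /=; rewrite HE EFinB.
Qed.

End SignedSubsetSum.

End SignedPairing.

(** * The Neumann series *)

Section Neumann.
Context {R : realType} {n : nat} {X : orientedRiemannian R n}.
Variable m : nonatomicRadon R X.
Local Notation Gamma0 := (borel (config X)).
Local Notation lambda := (lebesgue_poisson m).
Implicit Types (f : Gamma0 -> \bar R) (F G b : Gamma0 -> R) (eta xi zeta : Gamma0).
Let hausX := @carrier_hausdorff R n X.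
Let scX := @carrier_second_countable R n X.

Let conv1E xi : Defs.conv1 xi = (xi == fset0)%:R :> R.
Proof.
rewrite /Defs.conv1; have [->|xi0] := eqVneq xi fset0; first by rewrite cardfs0.
by rewrite expr0n cardfs_eq0 (negbTE xi0).
Qed.

(** Only the empty configuration contributes, and it has mass 1. *)
Lemma integral_conv1 : (\int[lambda]_xi (Defs.conv1 xi : R)%:E = 1)%E.
Proof.
have mc : measurable_fun setT (fun xi : Gamma0 => (Defs.conv1 xi : R)%:E).
  by apply/measurable_EFinP; exact: measurable_conv1.
have c0 xi : (0 <= (Defs.conv1 xi : R)%:E)%E by rewrite conv1E lee_fin.
rewrite integral_lebesgue_poisson// (nneseries_split 0 1)//; last first.
  by move=> k _; apply: mule_ge0; [rewrite lee_fin invr_ge0|exact: integral_ge0].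
rewrite big_nat1 eseries0 ?adde0; last first.
  move=> [//|k] _ _; rewrite integral0_eq ?mule0// => t _.
  rewrite conv1E (_ : _ == _ = false)//; apply/negbTE/fset0Pn.
  by exists (thead t); rewrite inE mem_tnth.
rewrite fact0 invr1 mul1e (eq_integral (cst 1%E)) => [|t _].
  by rewrite integral_cst//= diracT mule1.
by rewrite config_of0 conv1E eqxx.
Qed.

(** The unit of the convolution acts as the identity. *)
Lemma pairing_conv1 f : measurable_fun setT f -> (forall xi, 0 <= f xi)%E ->
  pairing m f (@Defs.conv1 R n X) =1 f.
Proof.
move=> mf f0 eta; rewrite -[RHS]mule1 -integral_conv1 -ge0_integralZl//.
- apply: eq_integral => xi _; rewrite conv1E.
  by have [->|] := eqVneq xi fset0; rewrite ?fsetU0// !mule0.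
- by apply/measurable_EFinP; exact: measurable_conv1.
- by move=> xi _; rewrite conv1E lee_fin.
Qed.

Lemma dual_op_conv1 G : dual_op m (@Defs.conv1 R n X) G =1 G.
Proof.
move=> eta; rewrite /dual_op /union_integrand.
transitivity (\int[lambda]_xi (Defs.conv1 xi * G eta)).
  apply: eq_Rintegral => xi _; rewrite conv1E.
  by have [->|] := eqVneq xi fset0; rewrite ?fsetU0 ?mulr0 ?mul0r// mulrC.
rewrite RintegralZr_measurable; last exact: measurable_conv1.
by rewrite /Rintegral integral_conv1 mul1r.
Qed.

Variables (a : Gamma0 -> R) (C delta M z : R).
Hypotheses (ma : measurable_fun [set: Gamma0] a) (C0 : 0 < C).
Hypotheses (z0 : 0 < z) (M0 : 0 <= M) (Mz : M < z).
Hypothesis bound : forall f, measurable_fun setT f -> (forall xi, 0 <= f xi)%E ->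
  (\int[lambda]_eta (pairing m f (fun xi => `|a xi|%R) eta * (weight C delta eta)%:E) <=
  M%:E * \int[lambda]_eta (f eta * (weight C delta eta)%:E))%E.

Let w eta : R := weight C delta eta.
Let w_gt0 eta : 0 < w eta. Proof. exact: weight_gt0. Qed.
Let mw : measurable_fun setT (fun eta => (w eta)%:E).
Proof. by apply/measurable_EFinP; exact: measurable_weight. Qed.

Let na xi := `|a xi|.
Let mna : measurable_fun [set: Gamma0] na. Proof. exact: measurableT_comp. Qed.
Let na0 xi : 0 <= na xi. Proof. exact: normr_ge0. Qed.

Let mp k : measurable_fun [set: Gamma0] (conv_exp na k).
Proof. exact: measurable_conv_exp. Qed.

Lemma conv_exp_ge0 (b : Gamma0 -> R) k : (forall xi, 0 <= b xi) ->
  forall xi, 0 <= conv_exp b k xi.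
Proof.
move=> b0; elim: k => [|k IH] xi; first by rewrite /= conv1E.
by apply: sumr_ge0 => zeta _; apply: mulr_ge0 => //; exact: IH.
Qed.

Lemma normr_conv_exp_le (b : Gamma0 -> R) k xi :
  `|conv_exp b k xi| <= conv_exp (fun zeta => `|b zeta|) k xi.
Proof.
elim: k xi => [|k IH] xi; first by rewrite /= conv1E ger0_norm.
apply: le_trans (ler_norm_sum _ _ _) _; apply: ler_sum => zeta _.
by rewrite normrM ler_wpM2l//; exact: IH.
Qed.

(* [T k] is the integral in the [k]-th term of the series for [G], and [S k] is
   its nonnegative majorant, built from the absolute values of [G] and [a]. *)
Section Fixed.
Variable G : Gamma0 -> R.
Hypothesis mG : measurable_fun [set: Gamma0] G.

Let T k eta : R := dual_op m (conv_exp a k) G eta.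
Let nG eta : \bar R := (`|G eta|)%:E.
Let S k eta : \bar R := pairing m nG (conv_exp na k) eta.

Let mnG : measurable_fun setT nG.
Proof. by apply/measurable_EFinP; exact: measurableT_comp. Qed.
Let nG0 eta : (0 <= nG eta)%E. Proof. by rewrite lee_fin. Qed.
Let mS k : measurable_fun setT (S k).
Proof. by apply: measurable_pairing => //; exact: conv_exp_ge0. Qed.
Let S0 k eta : (0 <= S k eta)%E.
Proof. by apply: pairing_ge0 => //; exact: conv_exp_ge0. Qed.

Let S_succ k : S k.+1 =1 pairing m (S k) na.
Proof. by apply: pairing_conv => //; exact: conv_exp_ge0. Qed.

Let integral_S k : (\int[lambda]_eta (S k eta * (w eta)%:E) <=
  (M ^+ k)%:E * L_norm m C delta G)%E.
Proof.
elim: k => [|k IH].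
  rewrite expr0 mul1e le_eqVlt; apply/orP; left; apply/eqP.
  by apply: eq_integral => eta _; rewrite [S 0 eta]pairing_conv1.
under eq_integral do rewrite S_succ.
apply: le_trans (bound (mS k) (S0 k)) _.
by rewrite exprS EFinM -muleA lee_wpmul2l// lee_fin.
Qed.

Let mUG : measurable_fun [set: Gamma0 * Gamma0]
  (fun u : Gamma0 * Gamma0 => G (u.1 `|` u.2)%fset).
Proof. exact: measurable_union_fun. Qed.

Let m_integrand k : measurable_fun [set: Gamma0 * Gamma0]
  (fun u : Gamma0 * Gamma0 => union_integrand G (conv_exp a k) u.1 u.2).
Proof.
apply: measurable_funM => //.
by apply: (measurableT_comp (measurable_conv_exp k ma)).
Qed.

Let mT k : measurable_fun [set: Gamma0] (T k).
Proof. exact: (measurable_Rintegral_lebesgue_poisson m (m_integrand k)). Qed.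

Let norm_integrand_le k eta xi :
  ((`|union_integrand G (conv_exp a k) eta xi|)%:E <=
   nG (eta `|` xi)%fset * (conv_exp na k xi)%:E)%E.
Proof.
rewrite -EFinM lee_fin normrM ler_wpM2l//; exact: normr_conv_exp_le.
Qed.

Let m_pairing_section k eta : measurable_fun setT
  (fun xi => nG (eta `|` xi)%fset * (conv_exp na k xi)%:E)%E.
Proof.
exact: (measurable_fun_pair2 eta (measurable_pairing_integrand mnG (mp k))).
Qed.

Let integrable_T k eta : (S k eta < +oo)%E ->
  lambda.-integrable setT (EFin \o union_integrand G (conv_exp a k) eta).
Proof.
move=> Soo; apply: (integrable_le_abs _ (m_pairing_section k eta)) => //.
exact: (measurable_fun_pair2 eta (m_integrand k)).
Qed.

Let norm_T k eta : ((`|T k eta|)%:E <= S k eta)%E.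
Proof.
have ms := measurable_fun_pair2 eta (m_integrand k).
apply: le_trans (normr_Rintegral_le lambda ms) _.
apply: ge0_le_integral => //.
by apply/measurable_EFinP; exact: measurableT_comp.
Qed.

(* Where [S k.+1] is finite, [T k.+1] is the operator applied to [T k], by the
   signed Minlos identity. *)
Let T_succ k eta : (S k.+1 eta < +oo)%E ->
  lambda.-integrable setT (EFin \o union_integrand (T k) a eta) /\
  T k.+1 eta = dual_op m a (T k) eta.
Proof.
move=> Soo; pose H xi zeta := union_integrand G (conv_exp a k) (eta `|` xi)%fset zeta * a xi.
have mH : measurable_fun [set: Gamma0 * Gamma0] (fun u : Gamma0 * Gamma0 => H u.1 u.2).
  apply: measurable_funM; last exact: (measurableT_comp ma).
  apply: (measurableT_comp (m_integrand k)
    (g := fun u : Gamma0 * Gamma0 => ((eta `|` u.1)%fset : Gamma0, u.2))).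
  apply: measurable_fun_pair => //.
  apply: (measurableT_comp (measurable_unionl (f := id) eta _) measurable_fst) => //.
have Hoo : (\int[lambda]_xi \int[lambda]_zeta (`|H xi zeta|)%:E < +oo)%E.
  apply: le_lt_trans Soo; rewrite S_succ; apply: ge0_le_integral => //.
  - by move=> xi _; apply: integral_ge0 => zeta _; rewrite lee_fin.
  - apply: (measurable_integral_lebesgue_poisson m (H := fun xi zeta => (`|H xi zeta|)%:E)).
      by apply/measurable_EFinP; exact: measurableT_comp.
    by move=> *; rewrite lee_fin.
  - exact: (measurable_fun_pair2 eta (measurable_pairing_integrand (mS k) mna)).
  move=> xi _; rewrite /S /pairing -ge0_integralZr//; last 2 first.
  - by move=> zeta _; apply: mule_ge0 => //; rewrite lee_fin conv_exp_ge0.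
  - by rewrite lee_fin.
  apply: ge0_le_integral => //.
  - apply/measurable_EFinP; apply: measurableT_comp => //.
    exact: (measurable_fun_pair2 xi mH).
  - by apply: emeasurable_funM.
  - move=> zeta _; rewrite /H normrM EFinM lee_wpmul2r ?lee_fin//.
    exact: norm_integrand_le.
have VE xi : \int[lambda]_zeta H xi zeta = union_integrand (T k) a eta xi.
  rewrite RintegralZr_measurable//.
  exact: (measurable_fun_pair2 _ (m_integrand k)).
have WE xi : \sum_(zeta <- fpowerset xi) H zeta (xi `\` zeta)%fset =
    union_integrand G (conv_exp a k.+1) eta xi.
  rewrite /union_integrand/= /Defs.conv mulr_sumr; apply: eq_big_seq => zeta zxi.
  rewrite /H /union_integrand -fsetUA fsetU_fpowerset//.
  by rewrite -mulrA [X in _ * X]mulrC.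
split.
  rewrite (_ : _ \o _ = EFin \o (fun xi => \int[lambda]_zeta H xi zeta)).
    exact: integrable_inner_Rintegral.
  by apply/funext => xi /=; rewrite VE.
transitivity (\int[lambda]_xi \sum_(zeta <- fpowerset xi) H zeta (xi `\` zeta)%fset).
  by apply: eq_Rintegral => xi _; rewrite WE.
by rewrite -Rintegral_subset_sum//; apply: eq_Rintegral => xi _; exact: VE.
Qed.

Let y k : R := (z ^+ k.+1)^-1.
Let y_gt0 k : 0 < y k. Proof. by rewrite invr_gt0 exprn_gt0. Qed.
Let y_ge0 k : 0 <= y k. Proof. exact: ltW. Qed.

(** The majorant of the Neumann series: the series of the absolute values, with
    the integrals taken with absolute values too. *)
Definition neumann_bound eta : \bar R :=
  (\sum_(k <oo) ((z ^+ k.+1)^-1)%:E *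
    pairing m (fun xi => (`|G xi|)%:E) (conv_exp (fun xi => `|a xi|%R) k) eta)%E.
Local Notation D := neumann_bound.

(** The terms of the Neumann series. *)
Definition neumann_term eta k : R :=
  (z ^+ k.+1)^-1 * \int[lambda]_xi union_integrand G (conv_exp a k) eta xi.
Local Notation t := neumann_term.

(** The sum of the Neumann series where the majorant is finite, and 0 elsewhere,
    which makes it measurable and bounded by the majorant everywhere. *)
Definition neumann_series eta : R :=
  if (neumann_bound eta < +oo)%E then limn (series (neumann_term eta)) else 0.
Local Notation B := neumann_series.

Let yS0 k eta : (0 <= (y k)%:E * S k eta)%E.
Proof. by apply: mule_ge0 => //; rewrite lee_fin. Qed.

Lemma neumann_bound_ge0 eta : (0 <= D eta)%E.
Proof. by apply: nneseries_ge0 => k _ _; exact: yS0. Qed.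

Lemma measurable_neumann_bound : measurable_fun setT D.
Proof.
apply: ge0_emeasurable_sum => [k eta _ _|k _]; first exact: yS0.
exact: (measurable_funeM _ (mS k)).
Qed.

Let D0 := neumann_bound_ge0.
Let mD := measurable_neumann_bound.

Let D_S k eta : (D eta < +oo -> S k eta < +oo)%E.
Proof.
move=> Doo; rewrite ltey; apply/eqP => Soo.
suff Dy : D eta = +oo%E by rewrite Dy in Doo.
apply: (nneseries_pinfty (k := k)) => //; first by move=> j _; exact: yS0.
by rewrite -/(S k eta) Soo gt0_muley// lte_fin y_gt0.
Qed.

Let geometric_sum N :
  \sum_(0 <= k < N) y k * M ^+ k * (z - M) = 1 - M ^+ N / z ^+ N.
Proof.
elim: N => [|N IH]; first by rewrite big_nil !expr0 divr1 subrr.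
rewrite big_nat_recr//= IH /y !exprS.
have zN : z ^+ N != 0 by rewrite expf_neq0// gt_eqF.
have z' : z != 0 by rewrite gt_eqF.
by field; rewrite zN.
Qed.

Let geometric_series : (\sum_(k <oo) (y k * M ^+ k)%:E <= ((z - M)^-1)%:E)%E.
Proof.
apply: lime_le.
  by apply: is_cvg_nneseries => k _ _; rewrite lee_fin mulr_ge0// exprn_ge0.
apply: nearW => N; rewrite sumEFin lee_fin -[leRHS]mul1r ler_pdivlMr ?subr_gt0//.
rewrite mulr_suml geometric_sum lerBlDr lerDl divr_ge0// exprn_ge0// ltW//.
Qed.

(** The [k]-th term of the majorant has a weighted integral of at most
    [M ^+ k / z ^+ k.+1] times the norm of [G]: a geometric series. *)
Lemma integral_neumann_bound : (L_norm m C delta G < +oo)%E ->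
  (\int[lambda]_eta (D eta * (w eta)%:E) <= ((z - M)^-1)%:E * L_norm m C delta G)%E.
Proof.
move=> Goo.
have N0 : (0 <= L_norm m C delta G)%E.
  by apply: integral_ge0 => eta _; rewrite lee_fin mulr_ge0// ltW.
have : L_norm m C delta G \is a fin_num by rewrite ge0_fin_numE.
move=> /fineK; set r := fine _ => rE.
have r0 : 0 <= r by rewrite -lee_fin rE.
apply: (@le_trans _ _ (\sum_(k <oo) r%:E * (y k * M ^+ k)%:E)%E); last first.
  rewrite nneseriesZl; last by move=> k _; rewrite lee_fin mulr_ge0// exprn_ge0.
  by rewrite -rE muleC lee_wpmul2r// lee_fin.
rewrite (_ : (\int[lambda]_eta _)%E =
    (\int[lambda]_eta \sum_(k <oo) (y k)%:E * (S k eta * (w eta)%:E))%E); last first.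
  apply: eq_integral => eta _; rewrite muleC -nneseriesZl => [|k _]; last exact: yS0.
  by apply: eq_eseriesr => k _; rewrite muleCA [X in (_ * X)%E]muleC.
have mSw k : measurable_fun setT (fun eta => S k eta * (w eta)%:E)%E.
  exact: emeasurable_funM.
have Sw0 k eta : (0 <= S k eta * (w eta)%:E)%E.
  by apply: mule_ge0 => //; rewrite lee_fin ltW.
rewrite integral_nneseries//; last 2 first.
- by move=> k; exact: measurable_funeM.
- by move=> k eta _; apply: mule_ge0; rewrite ?lee_fin.
apply: lee_nneseries => [k _ _|k _].
  by apply: integral_ge0 => eta _; apply: mule_ge0; rewrite ?lee_fin.
rewrite ge0_integralZl//; last by rewrite lee_fin.
rewrite EFinM [leRHS]muleCA lee_wpmul2l ?lee_fin// [leRHS]muleC rE.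
exact: integral_S.
Qed.

Let measurable_term k : measurable_fun [set: Gamma0] (t ^~ k).
Proof. by apply: measurable_funM => //; exact: mT. Qed.

Let norm_term k eta : ((`|t eta k|)%:E <= (y k)%:E * S k eta)%E.
Proof.
rewrite /t normrM (ger0_norm (y_ge0 k)) EFinM lee_wpmul2l ?lee_fin//.
exact: norm_T.
Qed.

Let norm_partial N eta : ((`|series (t eta) N|)%:E <= D eta)%E.
Proof.
apply: (@le_trans _ _ (\sum_(0 <= k < N) (y k)%:E * S k eta)%E).
  apply: (@le_trans _ _ (\sum_(0 <= k < N) `|t eta k|)%:E).
    by rewrite lee_fin; exact: ler_norm_sum.
  by rewrite -sumEFin; apply: lee_sum => k _; exact: norm_term.
by apply: nneseries_lim_ge => k _ _; exact: yS0.
Qed.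

Lemma neumann_series_cvg eta : (D eta < +oo)%E -> series (t eta) @ \oo --> B eta.
Proof.
move=> Doo; rewrite /B Doo; apply: normed_cvg.
have Dfin : D eta \is a fin_num by rewrite ge0_fin_numE.
apply: nondecreasing_is_cvgn.
  apply/nondecreasing_seqP => N.
  suff : \sum_(0 <= k < N) `|t eta k| <= \sum_(0 <= k < N.+1) `|t eta k| by [].
  by rewrite big_nat_recr//= lerDl.
exists (fine (D eta)) => _ [N _ <-]; rewrite -lee_fin fineK// /series/=.
rewrite -sumEFin; apply: (@le_trans _ _ (\sum_(0 <= k < N) (y k)%:E * S k eta)%E).
  by apply: lee_sum => k _; exact: norm_term.
by apply: nneseries_lim_ge => k _ _; exact: yS0.
Qed.

Lemma normr_neumann_series_le eta : ((`|B eta|)%:E <= D eta)%E.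
Proof.
have [Doo|] := ltP (D eta) +oo%E; last first.
  by rewrite leye_eq => /eqP ->; rewrite leey.
have Dfin : D eta \is a fin_num by rewrite ge0_fin_numE.
rewrite -(fineK Dfin) lee_fin.
have /cvg_norm cB := neumann_series_cvg Doo.
rewrite -(cvg_lim _ cB)//; apply: limr_le; first by apply/cvg_ex; eexists; exact: cB.
by apply: nearW => N; rewrite -lee_fin fineK.
Qed.

Lemma measurable_neumann_series : measurable_fun [set: Gamma0] B.
Proof.
apply: (measurable_fun_cvg (h := fun N eta =>
    if (D eta < +oo)%E then series (t eta) N else 0)) => [N|eta _].
  apply: measurable_fun_ifT => //.
    by apply: measurable_fun_lte.
  by apply: measurable_sum => k; exact: measurable_term.
have [Doo|/negbTE Doo] := boolP (D eta < +oo)%E.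
  exact: neumann_series_cvg.
by rewrite /B Doo; exact: cvg_cst.
Qed.

Lemma neumann_integrable k eta : (D eta < +oo)%E ->
  lambda.-integrable setT (EFin \o union_integrand G (conv_exp a k) eta).
Proof. by move=> Doo; apply: integrable_T; exact: D_S. Qed.

Let mB := measurable_neumann_series.

(** Pairing the majorant with [|a|] shifts the index in its series by one: the
    result is [z] times the majorant deprived of its first term. *)
Lemma neumann_pairing_lt eta : (D eta < +oo)%E -> (pairing m D na eta < +oo)%E.
Proof.
move=> Doo; rewrite /pairing.
have mD' : measurable_fun setT (fun xi => D (eta `|` xi)%fset).
  exact: measurable_unionl.
have mna' : measurable_fun setT (fun xi => (na xi)%:E) by apply/measurable_EFinP.
have mSu k : measurable_fun setT (fun xi => S k (eta `|` xi)%fset).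
  exact: measurable_unionl.
have Sna0 k xi : (0 <= S k (eta `|` xi)%fset * (na xi)%:E)%E.
  by apply: mule_ge0 => //; rewrite lee_fin.
have mSna k : measurable_fun setT (fun xi => S k (eta `|` xi)%fset * (na xi)%:E)%E.
  exact: emeasurable_funM.
rewrite (_ : (\int[lambda]_xi _)%E = (\int[lambda]_xi
    \sum_(k <oo) (y k)%:E * (S k (eta `|` xi)%fset * (na xi)%:E))%E); last first.
  apply: eq_integral => xi _; rewrite muleC -nneseriesZl => [|k _]; last exact: yS0.
  by apply: eq_eseriesr => k _; rewrite muleCA [X in (_ * X)%E]muleC.
rewrite integral_nneseries//; last 2 first.
- by move=> k; exact: measurable_funeM.
- by move=> k xi _; apply: mule_ge0; rewrite ?lee_fin.
rewrite (_ : (\sum_(k <oo) _)%E = (\sum_(k <oo) z%:E * ((y k.+1)%:E * S k.+1 eta))%E); last first.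
  apply: eq_eseriesr => k _; rewrite ge0_integralZl//; last by rewrite lee_fin.
  rewrite S_succ muleA -EFinM; congr (_%:E * _)%E.
  by rewrite /y [in RHS]exprS invfM mulVKf// gt_eqF.
rewrite nneseriesZl; last by move=> k _; exact: yS0.
apply: lte_mul_pinfty; [by rewrite lee_fin ltW|by []|].
apply: le_lt_trans Doo.
have -> : D eta = ((y 0)%:E * S 0 eta + \sum_(k <oo) (y k.+1)%:E * S k.+1 eta)%E.
  rewrite [LHS](nneseries_split (f := fun k => (y k)%:E * S k eta)%E 0 1) => [|k _].
    rewrite big_nat1; congr (_ + _)%E.
    rewrite -(nneseries_addn (f := fun k => (y k)%:E * S k eta)%E 1) => [|k].
      by apply: eq_eseriesr => k _; rewrite addn1.
    exact: yS0.
  exact: yS0.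
by apply: leeDr; exact: yS0.
Qed.

(** Where the majorant is finite, the operator applied to the Neumann series can
    be computed term by term, by dominated convergence; this turns the [k]-th
    term into [z] times the next one, and the term of index 0 is [G / z]. *)
Lemma neumann_series_resolvent eta : (D eta < +oo)%E ->
  lambda.-integrable setT (EFin \o union_integrand B a eta) /\
  z * B eta - dual_op m a B eta = G eta.
Proof.
move=> Doo; have Poo := neumann_pairing_lt Doo.
have mg : measurable_fun setT (fun xi => D (eta `|` xi)%fset * (na xi)%:E)%E.
  exact: (measurable_fun_pair2 eta (measurable_pairing_integrand mD mna)).
have g0 xi : (0 <= D (eta `|` xi)%fset * (na xi)%:E)%E.
  by apply: mule_ge0 => //; rewrite lee_fin.
have ig : lambda.-integrable setT (fun xi => D (eta `|` xi)%fset * (na xi)%:E)%E.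
  apply/integrableP; split => //.
  by under eq_integral do rewrite gee0_abs//.
pose f N xi := series (t (eta `|` xi)%fset) N * a xi.
have mt k : measurable_fun [set: Gamma0] (fun xi => t (eta `|` xi)%fset k).
  exact: (measurable_unionl (f := t ^~ k)).
have mf N : measurable_fun [set: Gamma0] (f N).
  by apply: measurable_funM; [exact: measurable_sum|exact: ma].
have mBa : measurable_fun [set: Gamma0] (union_integrand B a eta).
  by apply: measurable_funM; [exact: (measurable_unionl (f := B))|exact: ma].
have [iB _ cB] : [/\ lambda.-integrable setT (EFin \o union_integrand B a eta),
    [sequence \int[lambda]_xi `|(f N xi)%:E - (union_integrand B a eta xi)%:E|]_N @ \oo --> 0 &
    [sequence \int[lambda]_xi (f N xi)%:E]_N @ \oo -->
      \int[lambda]_xi (union_integrand B a eta xi)%:E]%E.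
  apply: (dominated_convergence (f_ := fun N => EFin \o f N) measurableT _ _ _ ig).
  - by move=> N; apply/measurable_EFinP.
  - exact/measurable_EFinP.
  - apply: filterS (integrable_ae measurableT ig) => xi /(_ I) gfin _.
    apply: cvg_EFin; first by apply: nearW.
    (* a finite majorant at [xi] leaves two cases: [a xi = 0], or the series
       converges at the union of [eta] and [xi] *)
    have [a0|a0] := eqVneq (a xi) 0.
      rewrite /union_integrand a0 mulr0 (_ : _ \o _ = cst 0); first exact: cvg_cst.
      by apply/funext => N; rewrite /f /= a0 mulr0.
    apply: cvgM; last exact: cvg_cst.
    apply: neumann_series_cvg; rewrite ltey; apply/eqP => Dy.
    by move: gfin; rewrite Dy gt0_mulye ?lte_fin ?normr_gt0.
  - apply: aeW => xi N _ /=; rewrite normrM EFinM lee_wpmul2r ?lee_fin//.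
(* the operator on the partial sums, term by term *)
have fE N : \int[lambda]_xi f N xi =
    \sum_(0 <= k < N) y k * T k.+1 eta.
  have it k : lambda.-integrable setT (EFin \o union_integrand (T k) a eta).
    by apply: (T_succ _).1; exact: D_S.
  have iN : lambda.-integrable setT (EFin \o f N).
    rewrite (_ : EFin \o _ = (fun xi => \sum_(0 <= k < N)
        (y k)%:E * (union_integrand (T k) a eta xi)%:E)%E); last first.
      apply/funext => xi; rewrite /f/= /series/= mulr_suml -sumEFin.
      by apply: eq_bigr => k _; rewrite -EFinM /union_integrand mulrA.
    by apply: integrable_sum => // k _; exact: (integrableZl measurableT _ (it k)).
  rewrite /Rintegral (eq_integral (fun xi => \sum_(0 <= k < N)
      (y k)%:E * (union_integrand (T k) a eta xi)%:E)%E) => [|xi _].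
    rewrite integral_sum//; last by move=> k; exact: (integrableZl measurableT _ (it k)).
    rewrite -[RHS]/(fine (_%:E)) -sumEFin; congr fine; apply: eq_bigr => k _.
    rewrite integralZl//; last exact: it.
    transitivity ((y k)%:E * (T k.+1 eta)%:E)%E; last by [].
    congr (_ * _)%E; rewrite (T_succ _).2; last exact: D_S.
    by rewrite fineK//; exact: (integrable_fin_num measurableT (it k)).
  rewrite /f/= /series/= mulr_suml -sumEFin.
  by apply: eq_bigr => k _; rewrite -EFinM /union_integrand mulrA.
split => //.
have cB' : (fun N => \sum_(0 <= k < N) y k * T k.+1 eta) @ \oo -->
    dual_op m a B eta.
  rewrite -[X in (X @ \oo) --> _](_ : (fun N => \int[lambda]_xi f N xi) = _).
    apply: fine_cvg; rewrite /dual_op /Rintegral fineK//.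
    exact: integrable_fin_num.
  by apply/funext.
have cz : (fun N => z * series (t eta) N.+1 - G eta) @ \oo --> z * B eta - G eta.
  apply: cvgB; last exact: cvg_cst.
  apply: cvgMl_tmp.
  by rewrite (cvg_shiftS (series (t eta))); exact: neumann_series_cvg.
(* the two sequences coincide, hence so do their limits *)
have zE : (fun N => z * series (t eta) N.+1 - G eta) =
    (fun N => \sum_(0 <= k < N) y k * T k.+1 eta).
  apply/funext => N; rewrite /series/= big_nat_recl// mulrDr.
  have -> : z * t eta 0 = G eta.
    rewrite /t expr1 mulrA mulfV ?gt_eqF// mul1r.
    exact: dual_op_conv1.
  rewrite addrAC subrr add0r mulr_sumr; apply: eq_bigr => k _.
  rewrite /t exprS invfM mulrA mulVKf// ?gt_eqF//.
rewrite zE in cz.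
have -> : dual_op m a B eta = z * B eta - G eta.
  exact: (cvg_unique _ cB' cz).
by rewrite opprB addrC subrK.
Qed.

End Fixed.

End Neumann.

(** * The resolvent *)

Section Resolvent.
Context {R : realType} {n : nat} {X : orientedRiemannian R n}.
Variable m : nonatomicRadon R X.
Local Notation Gamma0 := (borel (config X)).
Local Notation lambda := (lebesgue_poisson m).
Implicit Types (f : Gamma0 -> \bar R) (F G U V : Gamma0 -> R) (eta xi zeta : Gamma0).
Variables (a : Gamma0 -> R) (C delta M : R).
Hypotheses (ma : measurable_fun [set: Gamma0] a) (C0 : 0 < C) (M0 : 0 <= M).
Hypothesis bound : forall f, measurable_fun setT f -> (forall xi, 0 <= f xi)%E ->
  (\int[lambda]_eta (pairing m f (fun xi => `|a xi|%R) eta * (weight C delta eta)%:E) <=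
  M%:E * \int[lambda]_eta (f eta * (weight C delta eta)%:E))%E.

Local Notation L := (L_space m C delta).
Local Notation N := (L_norm m C delta).
Local Notation A := (dual_op m a).
Local Notation w := (weight C delta).

Let w_gt0 eta : 0 < w eta. Proof. exact: weight_gt0. Qed.
Let w_ge0 eta : 0 <= w eta. Proof. exact: ltW. Qed.
Let mw : measurable_fun [set: Gamma0] (w : Gamma0 -> R).
Proof. exact: measurable_weight. Qed.
Let mna : measurable_fun [set: Gamma0] (fun xi => `|a xi|).
Proof. exact: measurableT_comp. Qed.

Let Fw0 F eta : (0 <= (`|F eta| * w eta)%:E)%E.
Proof. by rewrite lee_fin; apply: mulr_ge0. Qed.

Lemma L_norm_ge0 F : (0 <= N F)%E.
Proof. by apply: integral_ge0 => eta _; exact: Fw0. Qed.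

Let mLn F : measurable_fun [set: Gamma0] F ->
  measurable_fun setT (fun eta => (`|F eta| * w eta)%:E).
Proof.
move=> mF; apply/measurable_EFinP; apply: measurable_funM; last exact: mw.
exact: measurableT_comp.
Qed.

Lemma L_norm_le (f : Gamma0 -> \bar R) F : measurable_fun [set: Gamma0] F ->
  measurable_fun setT f ->
  (forall eta, (`|F eta|)%:E <= f eta)%E ->
  (N F <= \int[lambda]_eta (f eta * (w eta)%:E))%E.
Proof.
move=> mF mf Ff; apply: ge0_le_integral => //.
- exact: mLn.
- by apply: emeasurable_funM => //; apply/measurable_EFinP; exact: mw.
- by move=> eta _; rewrite EFinM lee_wpmul2r// lee_fin.
Qed.

Lemma L_space_lincomb (c : R) F G : L F -> L G -> L (fun eta => c * F eta + G eta).
Proof.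
move=> [mF Foo] [mG Goo].
have mFG : measurable_fun [set: Gamma0] (fun eta => c * F eta + G eta).
  by apply: measurable_funD => //; exact: measurable_funM.
split => //.
apply: (@le_lt_trans _ _ (`|c|%:E * N F + N G)%E).
  rewrite -ge0_integralZl//; last exact: mLn.
  have F0 eta : (0 <= `|c|%:E * (`|F eta| * w eta)%:E)%E.
    by apply: mule_ge0 => //; rewrite lee_fin.
  rewrite -(ge0_integralD _ measurableT (fun eta _ => F0 eta)
    (measurable_funeM _ (mLn mF)) (fun eta _ => Fw0 G eta) (mLn mG)).
  apply: ge0_le_integral => //.
  - by move=> eta _; exact: (Fw0 (fun y => c * F y + G y)).
  - exact: (mLn mFG).
  - exact: (emeasurable_funD (measurable_funeM _ (mLn mF)) (mLn mG)).
  move=> eta _; rewrite -EFinM -EFinD lee_fin [X in _ <= X + _]mulrA -mulrDl ler_wpM2r//.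
  by rewrite (le_trans (ler_normD _ _))// normrM.
by apply: lte_add_pinfty => //; apply: lte_mul_pinfty.
Qed.

(** A function with a finite weighted integral is finite almost everywhere, the
    weight being positive. *)
Lemma ae_lty_weight f : measurable_fun setT f -> (forall eta, 0 <= f eta)%E ->
  (\int[lambda]_eta (f eta * (w eta)%:E) < +oo)%E ->
  \forall eta \ae lambda, (f eta < +oo)%E.
Proof.
move=> mf f0 foo.
have mfw : measurable_fun setT (fun eta => f eta * (w eta)%:E)%E.
  by apply: emeasurable_funM => //; apply/measurable_EFinP; exact: mw.
have fw0 eta : (0 <= f eta * (w eta)%:E)%E by apply: mule_ge0; rewrite ?lee_fin.
have ifw : lambda.-integrable setT (fun eta => f eta * (w eta)%:E)%E.
  by apply/integrableP; split => //; under eq_integral do rewrite gee0_abs//.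
apply: filterS (integrable_ae measurableT ifw) => eta /(_ I).
by rewrite ltey; apply: contraTneq => ->; rewrite gt0_mulye ?lte_fin.
Qed.

Lemma L_norm_eq0 F : measurable_fun [set: Gamma0] F -> N F = 0%E ->
  \forall eta \ae lambda, F eta = 0.
Proof.
move=> mF NF0.
have /(ae_eq_integral_abs lambda measurableT (mLn mF)) :
    (\int[lambda]_eta `|(`|F eta| * w eta)%:E| = 0)%E.
  rewrite -NF0; apply: eq_integral => eta _.
  by rewrite gee0_abs//; exact: Fw0.
apply: filterS => eta /(_ I) [] /eqP.
by rewrite mulf_eq0 (gt_eqF (w_gt0 eta)) orbF normr_eq0 => /eqP.
Qed.

Section OneFunction.
Variable F : Gamma0 -> R.
Hypothesis LF : L F.

Let mF : measurable_fun [set: Gamma0] F. Proof. by case: LF. Qed.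
Let nF eta : \bar R := (`|F eta|)%:E.
Let mnF : measurable_fun setT nF.
Proof. by apply/measurable_EFinP; exact: measurableT_comp. Qed.
Let nF0 eta : (0 <= nF eta)%E. Proof. by rewrite lee_fin. Qed.
Let P := pairing m nF (fun xi => `|a xi|).
Let mP : measurable_fun setT P. Proof. by apply: measurable_pairing. Qed.
Let P0 eta : (0 <= P eta)%E. Proof. by apply: pairing_ge0. Qed.
Let mUF : measurable_fun [set: Gamma0 * Gamma0]
  (fun u : Gamma0 * Gamma0 => union_integrand F a u.1 u.2).
Proof.
apply: measurable_funM; first exact: measurable_union_fun.
exact: (measurableT_comp ma).
Qed.

Let boundP : (\int[lambda]_eta (P eta * (w eta)%:E) <= M%:E * N F)%E.
Proof. exact: bound. Qed.

Lemma dual_op_ae_integrable : \forall eta \ae lambda,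
  lambda.-integrable setT (EFin \o union_integrand F a eta).
Proof.
have Poo : (\int[lambda]_eta (P eta * (w eta)%:E) < +oo)%E.
  by apply: le_lt_trans boundP _; apply: lte_mul_pinfty => //; case: LF.
apply: filterS (ae_lty_weight mP P0 Poo) => eta Peta.
apply: (integrable_le_abs _ _ _ Peta).
- exact: (measurable_fun_pair2 eta mUF).
- exact: (measurable_fun_pair2 eta (measurable_pairing_integrand mnF mna)).
- by move=> xi; rewrite -EFinM normrM.
Qed.

Let mA : measurable_fun [set: Gamma0] (A F).
Proof. exact: (measurable_Rintegral_lebesgue_poisson m mUF). Qed.

Lemma dual_op_bounded : (N (A F) <= M%:E * N F)%E.
Proof.
apply: le_trans boundP; apply: L_norm_le => // eta.
apply: le_trans (normr_Rintegral_le lambda (measurable_fun_pair2 eta mUF)) _.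
rewrite le_eqVlt; apply/orP; left; apply/eqP; apply: eq_integral => xi _.
by rewrite -EFinM normrM.
Qed.

Lemma dual_op_L_space : L (A F).
Proof.
split => //; apply: le_lt_trans dual_op_bounded _.
by apply: lte_mul_pinfty => //; case: LF.
Qed.

(** The operator is defined on the whole space. *)
Lemma L_space_dual_op_dom : dual_op_dom m C delta a F.
Proof. by split => //; [exact: dual_op_ae_integrable|exact: dual_op_L_space]. Qed.

End OneFunction.

Lemma dual_op_lincomb (c : R) F G : L F -> L G ->
  \forall eta \ae lambda, A (fun y => c * F y + G y) eta = c * A F eta + A G eta.
Proof.
move=> LF LG.
apply: filterS2 (dual_op_ae_integrable LF) (dual_op_ae_integrable LG) => eta iF iG.
rewrite /dual_op -RintegralZl// -RintegralD//.
  by apply: eq_Rintegral => xi _; rewrite /union_integrand mulrDl mulrA.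
exact: (integrableZl measurableT c iF).
Qed.

Section Inverse.
Variable z : R.
Hypothesis Mz : M < z.
Let z0 : 0 < z. Proof. exact: le_lt_trans Mz. Qed.

(** If [z F = A F], then [z N F = N (A F) <= M N F] with [M < z], hence
    [N F = 0]. *)
Lemma resolvent_injective F : L F ->
  (\forall eta \ae lambda, z * F eta - A F eta = 0) ->
  \forall eta \ae lambda, F eta = 0.
Proof.
move=> LF zFA; have [mF Foo] := LF; have [mAF _] := dual_op_L_space LF.
have NE : N (A F) = (z%:E * N F)%E.
  rewrite -ge0_integralZl//; last 2 first.
  - exact: mLn.
  - by rewrite lee_fin ltW.
  apply: ge0_ae_eq_integral => //.
  - exact: mLn.
  - by apply: measurable_funeM; exact: mLn.
  - by move=> eta _; apply: mule_ge0 => //; rewrite lee_fin ltW.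
  apply: filterS zFA => eta /eqP; rewrite subr_eq0 => /eqP zF _.
  by rewrite -zF normrM (gtr0_norm z0) -mulrA EFinM.
apply: L_norm_eq0 => //; have N0 := L_norm_ge0 F.
have := dual_op_bounded LF; rewrite NE.
have : N F \is a fin_num by rewrite ge0_fin_numE.
move=> /fineK <-; rewrite -!EFinM lee_fin => h; congr EFin.
apply/eqP; rewrite eq_le fine_ge0// andbT.
by rewrite -(@pmulr_rle0 _ (z - M)) ?subr_gt0// mulrBl subr_le0.
Qed.

Lemma resolvent_unique U V G : L U -> L V ->
  (\forall eta \ae lambda, z * U eta - A U eta = G eta) ->
  (\forall eta \ae lambda, z * V eta - A V eta = G eta) ->
  \forall eta \ae lambda, U eta = V eta.
Proof.
move=> LU LV UG VG.
have : \forall eta \ae lambda, -1 * V eta + U eta = 0.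
  apply: resolvent_injective; first exact: L_space_lincomb.
  apply: filterS3 UG VG (dual_op_lincomb (-1) LV LU) => eta uG vG ->.
  transitivity ((z * U eta - A U eta) - (z * V eta - A V eta)); first by ring.
  by rewrite uG vG subrr.
by apply: filterS => eta /eqP; rewrite mulN1r addrC subr_eq0 => /eqP.
Qed.

Local Notation B := (neumann_series m a z).

Section Solution.
Variable G : Gamma0 -> R.
Hypothesis LG : L G.
Let mG : measurable_fun [set: Gamma0] G. Proof. by case: LG. Qed.
Let Goo : (N G < +oo)%E. Proof. by case: LG. Qed.

Lemma neumann_series_norm : (N (B G) <= ((z - M)^-1)%:E * N G)%E.
Proof.
apply: le_trans (integral_neumann_bound ma C0 z0 M0 Mz bound mG Goo).
apply: L_norm_le.
- exact: measurable_neumann_series.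
- exact: measurable_neumann_bound.
- exact: normr_neumann_series_le.
Qed.

Lemma neumann_series_L_space : L (B G).
Proof.
split; first exact: measurable_neumann_series.
apply: le_lt_trans neumann_series_norm _; apply: lte_mul_pinfty => //.
by rewrite lee_fin invr_ge0 subr_ge0 ltW.
Qed.

Lemma neumann_bound_ae_lty : \forall eta \ae lambda, (neumann_bound m a z G eta < +oo)%E.
Proof.
apply: ae_lty_weight.
- exact: measurable_neumann_bound.
- exact: neumann_bound_ge0.
apply: le_lt_trans (integral_neumann_bound ma C0 z0 M0 Mz bound mG Goo) _.
by apply: lte_mul_pinfty => //; rewrite lee_fin invr_ge0 subr_ge0 ltW.
Qed.

Lemma neumann_series_solution :
  \forall eta \ae lambda, z * B G eta - A (B G) eta = G eta.
Proof.
apply: filterS neumann_bound_ae_lty => eta Doo.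
exact: (neumann_series_resolvent ma z0 mG Doo).2.
Qed.

End Solution.

Lemma neumann_series_is_resolvent :
  is_resolvent lambda L N (dual_op_dom m C delta a) A z B.
Proof.
split.
- split.
  + by move=> F LF; exact: neumann_series_L_space.
  + move=> c F G LF LG; have LB := neumann_series_L_space.
    apply: (resolvent_unique (G := fun y => c * F y + G y)).
    * by apply: LB; exact: L_space_lincomb.
    * by apply: L_space_lincomb; exact: LB.
    * by apply: neumann_series_solution; exact: L_space_lincomb.
    apply: filterS3 (neumann_series_solution LF) (neumann_series_solution LG)
      (dual_op_lincomb c (LB _ LF) (LB _ LG)) => eta <- <- ->.
    move: (B F eta) (B G eta) (A (B F) eta) (A (B G) eta) => u v u' v'.
    by ring.
  + by exists (z - M)^-1 => F; exact: neumann_series_norm.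
- move=> G LG; split; last exact: neumann_series_solution.
  by apply: L_space_dual_op_dom; exact: neumann_series_L_space.
- move=> F [LF _ LAF].
  have LzF : L (fun y => z * F y - A F y).
    (* [z F - A F] as an iterated combination [c F + G] *)
    rewrite (_ : (fun y => _) = (fun y => -1 * A F y + ((z - 1) * F y + F y))).
      by apply: L_space_lincomb => //; exact: L_space_lincomb.
    apply/funext => y; move: (A F y) (F y) => u v; by ring.
  apply: (resolvent_unique (G := fun y => z * F y - A F y)) => //.
  + exact: neumann_series_L_space.
  + exact: neumann_series_solution.
  + exact: aeW.
Qed.

End Inverse.

End Resolvent.

Unset Implicit Arguments.
Set Strict Implicit.
Set Printing Implicit Defensive.

Theorem proposition4p3 (R : realType) (n : nat) (X : orientedRiemannian R n)
    (m : nonatomicRadon R X) (a : borel (config X) -> R) (Ca da C delta : R)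
    (Ca_gt0 : 0 < Ca) (da_ge0 : 0 <= da) (aK : K_space m Ca da a)
    (CaC : Ca < C) (delta_ge : Num.max da 1 <= delta) :
  exists2 z0 : R, 0 < z0 & forall z : R, z0 < z ->
    exists2 Rz : (borel (config X) -> R) -> (borel (config X) -> R),
      is_resolvent (lebesgue_poisson m) (L_space m C delta) (L_norm m C delta)
        (dual_op_dom m C delta a) (dual_op m a) z Rz &
      forall G, L_space m C delta G ->
        \forall eta \ae lebesgue_poisson m,
          (forall k : nat, (lebesgue_poisson m).-integrable setT
             (EFin \o union_integrand G (conv_exp a k) eta)) /\
          series (fun k : nat => (z ^+ k.+1)^-1 *
            \int[lebesgue_poisson m]_xi union_integrand G (conv_exp a k) eta xi)
            @ \oo --> Rz G eta.
Proof.
have [M M0 bound] := pairing_weight_le Ca_gt0 aK CaC delta_ge.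
have ma := aK.1; have C0 : 0 < C by exact: lt_trans CaC.
(* the bound [M] itself may be 0 *)
exists (M + 1) => [|z Mz]; first by rewrite ltr_wpDl.
have {}Mz : M < z by apply: lt_trans Mz; rewrite ltrDl.
have z0 : 0 < z by exact: le_lt_trans Mz.
exists (neumann_series m a z); first exact: (neumann_series_is_resolvent ma C0 M0 bound Mz).
move=> G LG; have [mG _] := LG.
apply: filterS (neumann_bound_ae_lty ma C0 M0 bound Mz LG) => eta Doo.
split => [k|]; first exact: (neumann_integrable ma z0 mG k Doo).
exact: (neumann_series_cvg ma z0 mG Doo).
Qed.
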